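(* Let $G$ be a finite abelian group such that $|G|$ is coprime to $6$. Then \[\lim_{n\to\infty} \mathbb{E}|\operatorname{Sur}(\operatorname{cok}(A_n),G)|=1.\]
   Context: Let $[n]=\{1,\dots,n\}$ and let $e_1,\dots,e_n$ be the standard basis of $\mathbb{R}^{[n]}$. Let $B_n$ be the matrix with columns indexed by $[n]$ and rows indexed by $[n]^3$ (all ordered triples, repetitions allowed), where the row corresponding to $(x_1,x_2,x_3)\in[n]^3$ is $e_{x_1}+e_{x_2}+e_{x_3}$. For an $n$-element subset $K\subset[n]^3$, let $B_n[K]$ be the $n\times n$ submatrix of $B_n$ formed by the rows with index in $K$. Let $X_n$ be the random $n$-element subset of $[n]^3$ with \[\mathbb{P}(X_n=K)=\frac{|\det(B_n[K])|^2}{\det(B_n^TB_n)}\] for every $n$-element subset $K\subset[n]^3$ (this is a probability measure by the Cauchy-Binet formula). The random $n\times n$ integer matrix $A_n$ is $A_n=B_n[X_n]$. The cokernel $\operatorname{cok}(A_n)$ is the quotient of $\mathbb{Z}^{[n]}$ by the subgroup generated by the rows of $A_n$; it is almost surely a finite abelian group. $\operatorname{Sur}(\Gamma,G)$ denotes the set of surjective group homomorphisms $\Gamma\to G$. *)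

(* Defs.v *)
From HB Require Import structures.
From mathcomp Require Import all_boot all_order all_algebra perm.
From mathcomp Require Import finmap.
From mathcomp Require Import all_classical all_reals all_analysis.

Set Implicit Arguments.
Unset Strict Implicit.
Unset Printing Implicit Defensive.

Import Order.TTheory GRing.Theory Num.Theory.
Import numFieldNormedType.Exports.

Local Open Scope classical_set_scope.
Local Open Scope ring_scope.

Definition triple (n : nat) := ('I_n * 'I_n * 'I_n)%type.

Definition triple_row (n : nat) (x : triple n) : 'rV[int]_n :=
  delta_mx 0 x.1.1 + delta_mx 0 x.1.2 + delta_mx 0 x.2.

(* The rows are listed in the order of [enum (triple n)]; neither [B^T *m B],
   nor the square of a maximal minor, nor a row lattice depends on it. *)
Definition Bmx (n : nat) : 'M[int]_(#|{: triple n}|, n) :=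
  \matrix_i triple_row (enum_val i).

Definition nsubset (n : nat) := {K : {set triple n} | #|K| == n}.

Definition nsubset_enum (n : nat) (K : nsubset n) (i : 'I_n) : triple n :=
  enum_val (cast_ord (esym (eqP (valP K))) i).

Definition Bsub (n : nat) (K : nsubset n) : 'M[int]_n :=
  rowsub (fun i => enum_rank (nsubset_enum K i)) (Bmx n).

Definition law (R : realType) (n : nat) (K : nsubset n) : R :=
  (`|\det (Bsub K)| ^+ 2)%:~R / (\det ((Bmx n)^T *m Bmx n))%:~R.

(* Expectation of [f X_n] when [X_n] has distribution [law R n]. *)
Definition expect (R : realType) (n : nat) (f : nsubset n -> R) : R :=
  \sum_(K : nsubset n) law R K * f K.

Section Cokernel.
Variables (m n : nat) (A : 'M[int]_(m, n)).

Definition row_lattice : {pred 'rV[int]_n} :=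
  fun v => `[< exists u : 'rV[int]_m, v = u *m A >].

Lemma row_lattice_zmod_closed : zmod_closed row_lattice.
Proof.
split=> [|v w /asboolP[a ->] /asboolP[b ->]]; apply/asboolP.
  by exists 0; rewrite mul0mx.
by exists (a - b); rewrite mulmxBl.
Qed.

HB.instance Definition _ :=
  GRing.isZmodClosed.Build 'rV[int]_n row_lattice row_lattice_zmod_closed.

Definition cok : zmodType := Quotient.quot row_lattice.

End Cokernel.

Definition Sur (U V : zmodType) : set (U -> V) :=
  [set f | zmod_morphism f /\ (forall y, exists x, f x = y)].
Arguments Sur : clear implicits.

(* [fset_set] of an infinite set is empty; [finite_Sur_cok] below shows that
   this does not occur for cokernels, including those of singular matrices. *)
Definition nb_Sur (U V : zmodType) : nat := #|` fset_set (Sur U V)|%fset.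
Arguments nb_Sur : clear implicits.

Lemma finite_Sur_cok (m n : nat) (A : 'M[int]_(m, n)) (G : finZmodType) :
  finite_set (Sur (cok A) G).
Proof.
pose Q := Quotient.quot (row_lattice A).
pose pi (v : 'rV[int]_n) : cok A := (\pi_Q v)%qT.
have piB : zmod_morphism pi.
  move=> x y; rewrite /pi (_ : (\pi_Q (x - y))%qT = (\pi_Q x - \pi_Q y)%qT) //.
  by rewrite !piE.
pose ev (f : cok A -> G) : {ffun 'I_n -> G} :=
  [ffun i => f (pi (delta_mx 0 i))].
have ev_inj : {in Sur (cok A) G &, injective ev}.
  move=> f g /set_mem[fB _] /set_mem[gB _] efg; apply/funext => q.
  have -> : q = pi (repr (q : Q)) by rewrite /pi reprK.
  have hB (h : cok A -> G) : zmod_morphism h -> zmod_morphism (h \o pi).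
    by move=> hh x y /=; rewrite piB hh.
  pose F : {additive 'rV[int]_n -> G} :=
    HB.pack (f \o pi) (GRing.isZmodMorphism.Build _ _ _ (hB f fB)).
  pose H : {additive 'rV[int]_n -> G} :=
    HB.pack (g \o pi) (GRing.isZmodMorphism.Build _ _ _ (hB g gB)).
  rewrite -[LHS]/(F _) -[RHS]/(H _) (row_sum_delta (repr (q : Q))) !raddf_sum.
  apply: eq_bigr => j _.
  have := congr1 (fun h : {ffun 'I_n -> G} => h j) efg; rewrite !ffunE => e.
  by rewrite -[_ 0 j]intz scaler_int !raddfMz; congr (_ *~ _).
pose S := Sur (cok A) G.
pose rv c := xget (fun=> 0) [set f : cok A -> G | S f /\ ev f = c].
apply: (@sub_finite_set _ _ (rv @` [set: {ffun 'I_n -> G}])).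
  move=> f Sf; exists (ev f) => //; rewrite /rv.
  case: xgetP => [g _ [Sg]|/(_ f)[]//].
  by apply: ev_inj; exact: mem_set.
by apply: finite_image; exact: finite_finset.
Qed.

(* Cauchy-Binet *)
Lemma det_Bmx_gram (n : nat) :
  \det ((Bmx n)^T *m Bmx n) = \sum_(K : nsubset n) `|\det (Bsub K)| ^+ 2.
Proof.
pose T := triple n; pose b (k : T) : 'rV[int]_n := triple_row k.
have bE k j : Bmx n (enum_rank k) j = b k 0 j by rewrite mxE enum_rankK.
have gramE i j : ((Bmx n)^T *m Bmx n) i j = \sum_(k : T) b k 0 i * b k 0 j.
  rewrite mxE (reindex (@enum_rank T)) /=; last first.
    by exists enum_val => k _; rewrite ?enum_valK ?enum_rankK.
  by apply: eq_bigr => k _; rewrite -!bE [in LHS]mxE.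
have BsubE (K : nsubset n) i j : Bsub K i j = b (nsubset_enum K i) 0 j.
  by rewrite -bE [in LHS]mxE.
pose D (f : 'I_n -> T) := \det (\matrix_(i, j) b (f i) 0 j).
transitivity (\sum_(f : {ffun 'I_n -> T}) (\prod_i b (f i) 0 i) * D f).
  rewrite /determinant; under eq_bigr => s _.
    under eq_bigr => i _ do rewrite gramE.
    rewrite bigA_distr_bigA big_distrr /=; over.
  rewrite exchange_big; apply: eq_bigr => f _.
  rewrite /D /determinant big_distrr; apply: eq_bigr => s _ /=.
  rewrite big_split /= mulrCA; congr (_ * (_ * _)).
  by apply: eq_bigr => i _; rewrite mxE.
rewrite (bigID (fun f : {ffun 'I_n -> T} => injectiveb f)) /=.
rewrite [X in _ + X]big1 ?addr0 => [|f /injectivePn[i [j ij fij]]]; last first.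
  by rewrite /D (determinant_alternate ij) ?mulr0 // => k; rewrite !mxE fij.
pose h (x : nsubset n * 'S_n) : {ffun 'I_n -> T} :=
  [ffun i => nsubset_enum x.1 (x.2 i)].
have en_inj (K : nsubset n) : injective (nsubset_enum K).
  by move=> i j /enum_val_inj/cast_ord_inj.
have en_in (K : nsubset n) i : nsubset_enum K i \in val K by exact: enum_valP.
have h_inj : injective h.
  move=> [K s] [K' s'] e.
  have e' i : nsubset_enum K (s i) = nsubset_enum K' (s' i).
    by have := congr1 (fun f : {ffun 'I_n -> T} => f i) e; rewrite !ffunE.
  have KK : K = K'.
    apply/val_inj/eqP; rewrite eqEcard (eqP (valP K)) (eqP (valP K')) leqnn.
    rewrite andbT; apply/fintype.subsetP => x xK.
    pose j := cast_ord (eqP (valP K)) (enum_rank_in xK x).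
    have <- : nsubset_enum K j = x.
      by rewrite /nsubset_enum cast_ordK enum_rankK_in.
    by rewrite -[j](permKV s) e' en_in.
  by subst K'; congr pair; apply/permP => i; exact: (en_inj _ _ _ (e' i)).
have imh : [set f : {ffun 'I_n -> T} | injectiveb f]%SET = (h @: [set: nsubset n * 'S_n])%SET.
  apply/esym/eqP; rewrite eqEcard; apply/andP; split.
    apply/fintype.subsetP => f /imsetP[[K s] _ ->]; rewrite inE; apply/injectiveP.
    by move=> i j; rewrite !ffunE => /en_inj/perm_inj.
  rewrite (card_imset _ h_inj) cardsT.
  have cN : #|{: nsubset n}| = 'C(#|{: T}|, n).
    by rewrite card_sig -card_draws; apply: eq_card => K; rewrite !inE.
  have cS : #|{: 'S_n}| = n`!.
    by rewrite -card_Sn; apply: eq_card => x; rewrite !inE.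
  rewrite card_prod cN cS bin_ffact -[X in _ ^_ X]card_ord -card_inj_ffuns.
  by rewrite cardsE.
rewrite -big_set imh big_imset /=; last by move=> x y _ _; exact: h_inj.
rewrite big_set /= -(pair_bigA _ (fun K s =>
  (\prod_i b (h (K, s) i) 0 i) * D (h (K, s)))) /=.
apply: eq_bigr => K _; rewrite real_normK ?num_real // expr2 -{2}det_tr [X in _ * X]/determinant.
rewrite big_distrr; apply: eq_bigr => s _ /=.
have -> : D (h (K, s)) = (-1) ^+ s * \det (Bsub K).
  rewrite -det_perm -det_mulmx -row_permE; congr determinant.
  by apply/matrixP => i j; rewrite [LHS]mxE [RHS]mxE BsubE ffunE.
rewrite mulrC -mulrA mulrCA; congr (_ * (_ * _)).
by apply: eq_bigr => i _; rewrite [RHS]mxE BsubE ffunE.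
Qed.

Lemma det_Bmx_gram_neq0 (n : nat) : \det ((Bmx n)^T *m Bmx n) != 0.
Proof.
rewrite det_Bmx_gram; apply/eqP => /eqP.
rewrite psumr_eq0 => [|K _]; last exact: exprn_ge0.
pose dg (i : 'I_n) : triple n := (i, i, i).
have dg_inj : injective dg by move=> i j [].
have cardK : #|(dg @: [set: 'I_n])%SET| == n.
  by rewrite (card_imset _ dg_inj) cardsT card_ord.
pose K : nsubset n := Sub (dg @: [set: 'I_n])%SET cardK.
move=> /allP /(_ K (mem_index_enum _)); rewrite /= sqrf_eq0 normr_eq0.
pose s i := (nsubset_enum K i).2.
have sE i : nsubset_enum K i = dg (s i).
  have : nsubset_enum K i \in val K by exact: enum_valP.
  by rewrite /s => /imsetP[j _ ->].
have s_inj : injective s.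
  by move=> i j e; have := sE i; rewrite e -sE => /enum_val_inj/cast_ord_inj.
have -> : Bsub K = 3%:M *m perm_mx (perm s_inj).
  apply/matrixP => i j; rewrite mul_scalar_mx !mxE enum_rankK sE permE.
  by rewrite ![j == _]eq_sym /=; case: (s i == j).
by rewrite det_mulmx det_scalar det_perm mulf_eq0 signr_eq0 expf_eq0 andbF.
Qed.

Lemma law_ge0 (R : realType) (n : nat) (K : nsubset n) : 0 <= law R K.
Proof.
rewrite divr_ge0// ler0z ?exprn_ge0// det_Bmx_gram.
by apply: sumr_ge0 => ? _; exact: exprn_ge0.
Qed.

Lemma law_sum1 (R : realType) (n : nat) : \sum_(K : nsubset n) law R K = 1.
Proof.
rewrite -mulr_suml -(rmorph_sum (intmul 1)) -det_Bmx_gram divff //.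
by rewrite intr_eq0 det_Bmx_gram_neq0.
Qed.

(* Main.v *)
Require Import Defs.
From HB Require Import structures.
From mathcomp Require Import all_boot all_order all_algebra perm.
From mathcomp Require Import finmap.
From mathcomp Require Import all_classical all_reals all_analysis.
From mathcomp Require Import ring lra.
Import Order.TTheory GRing.Theory Num.Theory.
Import numFieldNormedType.Exports.

(** A surjection from the cokernel of [Bsub K] onto [G] is a tuple [q] in [G ^ n]
    that generates [G] and is annihilated by every row in [K]. Summing the law of
    [K] over the sets of rows annihilating [q], the Cauchy-Binet formula turns the
    expectation into a sum of ratios of determinants, over all generating [q]:
    the Gram matrix of the rows [e_x1 + e_x2 + e_x3] with
    [q x1 + q x2 + q x3 = 0], over the Gram matrix of all rows
    ([det_weighted_gram], [nb_Sur_cok], [expect_nb_Sur]).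

    Let [nu] be the empirical distribution of the values of [q] and let
    [p a = \sum_b nu b * nu (- a - b)], the law of minus the sum of two independent
    samples of [nu]. The Gram matrix of [q] is diagonal with entries
    [3 n^2 p (q i)], plus a matrix of rank at most [#|G|] that depends on [i] and
    [j] only through [q i] and [q j] ([gramE]). So the ratio is at most
    [\prod_i p (q i)] up to a bounded factor ([det_gram_le]), and an exact formula with a
    [#|G|]-dimensional determinant is available ([det_gram_transition]).

    There are about [exp (n * entropy nu)] tuples with distribution [nu], and their
    total weight is exponentially small in [n] times the squared Hellinger distance
    between [nu] and [p] ([prod_le_far]). Only near solutions of [nu = p]
    contribute. When 3 does not divide [#|G|] the solutions are the uniform
    measures of the subgroups of [G], and for small [t] a solution up to [t] is
    within [6 t] of one of them ([stability]). With [t = n^(-2/5)], the quantity [n t^2] is a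
    positive power of [n], which beats the polynomial number of types, whereas
    [n t^3] tends to 0, which makes every expansion to second order exact in the
    limit.

    - Near the uniform measure of [G], the first and second order terms of
      [\sum_i ln (#|G| * p (q i))] cancel, and the [#|G|]-dimensional determinant
      tends to the value 3 that it has for all rows. Each such [q] has weight
      [#|G|^(-n) (1 + o(1))], and almost all of [G ^ n] is of this kind: this part
      of the sum tends to 1 ([bulk_term_bound], [not_bulk_sum_le]).

    - Near the uniform measure of a proper subgroup [H], a generating [q] takes
      [k >= 1] values outside [H]. Comparing [\prod_i p (q i)] with a product
      measure shows that the tuples with given [k] weigh at most a constant times
      [(2 / e)^k] up to subexponential factors ([near_prod]), which is summable in
      [k] but not small. The missing factor [k^3 / n] comes from the determinant:
      since [#|G|] is odd, a coset [a + H <> H] differs from [- a + H], and a vector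
      equal to 1 on the first and [- 1] on the second is orthogonal to every row
      annihilating [q], except those whose three values avoid [H]
      ([det_gram_escape]). Hence this part of
      the sum is [O(1/n)] ([near_term_le], [near_sum_bound]). *)

Set Implicit Arguments.
Unset Strict Implicit.
Unset Printing Implicit Defensive.

Local Open Scope ring_scope.

(** * Determinants and positive semidefinite matrices *)

(** Sylvester's identity: both sides are the determinant of the block matrix
    with rows [1, - A] and [B, 1], eliminated from either corner. *)
Lemma det_add1_mulmxC (R : comNzRingType) m n (A : 'M[R]_(m, n)) (B : 'M[R]_(n, m)) :
  \det (1%:M + A *m B) = \det (1%:M + B *m A).
Proof.
pose X := block_mx 1%:M (- A) B 1%:M.
have E1 : X = block_mx 1%:M 0 B 1%:M *m block_mx 1%:M (- A) 0 (1%:M + B *m A).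
  rewrite mulmx_block !mul1mx !mul0mx !mulmx1 !addr0 mulmxN.
  by rewrite addrCA addNr addr0.
have E2 : X = block_mx (1%:M + A *m B) (- A) 0 1%:M *m block_mx 1%:M 0 B 1%:M.
  rewrite mulmx_block !mul1mx !mulmx0 !mulmx1 ?mul0mx !add0r mulNmx.
  by rewrite addrK.
have : \det X = \det X by [].
rewrite {1}E1 E2 !det_mulmx !det_lblock !det_ublock !det1 ?mulr1 ?mul1r.
by move->.
Qed.

Definition psd (F : numDomainType) n (M : 'M[F]_n) :=
  M^T = M /\ forall v : 'rV[F]_n, 0 <= (v *m M *m v^T) 0 0.

Lemma psd_congr (F : numDomainType) m n (P : 'M[F]_(m, n)) (M : 'M[F]_n) :
  psd M -> psd (P *m M *m P^T).
Proof.
case=> sM pM; split; first by rewrite !trmx_mul trmxK sM mulmxA.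
by move=> v; have := pM (v *m P); rewrite trmx_mul !mulmxA.
Qed.

Lemma qform_block (F : comNzRingType) n (a : 'M[F]_1) b (N : 'M[F]_n)
    (s : 'M[F]_1) (w : 'rV[F]_n) :
  row_mx s w *m block_mx a b b^T N *m (row_mx s w)^T =
  s *m a *m s + (w *m b^T *m s + (s *m b + w *m N) *m w^T).
Proof.
rewrite mul_row_block tr_row_mx mul_row_col !mulmxDl.
rewrite (_ : s^T = s); last by apply/matrixP=> i j; rewrite mxE !ord1.
by rewrite !addrA.
Qed.

(** Schur complementation: eliminating the first coordinate keeps a matrix
    positive semidefinite and can only decrease its other diagonal entries. *)
Lemma det_psd_bounds (F : realFieldType) n (M : 'M[F]_n) :
  psd M -> 0 <= \det M <= \prod_i M i i.
Proof.
elim: n M => [|n IHn] M; first by rewrite det_mx00 big_ord0 lexx ler01.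
rewrite -[n.+1]/(1 + n)%N in M *.
rewrite -[M]submxK; set a := ulsubmx M; set b := ursubmx M.
set c := dlsubmx M; set N := drsubmx M.
case=> sM pM.
have [_ cb bc sN] : [/\ a^T = a, c^T = b, b^T = c & N^T = N].
  by move: sM; rewrite tr_block_mx => /eq_block_mx.
rewrite -bc in pM *.
rewrite big_split_ord /= big_ord1.
have -> : \prod_(i < n) block_mx a b b^T N (rshift 1 i) (rshift 1 i) =
          \prod_i N i i.
  by apply: eq_bigr => i _; rewrite block_mxEdr.
rewrite block_mxEul; set al := a 0 0.
have aE : a = al%:M by rewrite [a]mx11_scalar.
have q0 (s : 'M[F]_1) (w : 'rV[F]_n) := pM (row_mx s w).
have al0 : 0 <= al.
  have := q0 1%:M 0; rewrite qform_block !mul0mx !mulmx1 mul1mx trmx0 mulmx0.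
  by rewrite !addr0.
have [al_eq0|al_neq0] := eqVneq al 0.
  (* A zero diagonal entry forces a zero row: the quadratic form would otherwise
     be affine and nonconstant in [t] along [t e_0 + e_j]. *)
  have b0 : b = 0.
    apply/rowP => j; rewrite [RHS]mxE.
    have Q t : 0 <= t * b 0 j *+ 2 + N j j.
      have := q0 t%:M (delta_mx 0 j).
      rewrite qform_block aE al_eq0 !mul_scalar_mx mulmxDl -!scalemxAl.
      rewrite -!rowE trmx_delta -!colE !mul_mx_scalar.
      rewrite raddf0 !scaler0 add0r !mxE; congr (_ <= _); ring.
    apply/eqP; apply: contraT => bj0.
    have := Q (- (N j j + 1) / (2 * b 0 j)).
    rewrite (_ : _ *+ 2 + _ = -1) ?ler0N1 //; field.
    by rewrite bj0.
  by rewrite b0 det_lblock aE al_eq0 det_scalar1 mul0r mul0r lexx.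
have al_gt0 : 0 < al by rewrite lt_def al_neq0.
pose N' := N - al^-1 *: (b^T *m b).
have E : block_mx a b b^T N = block_mx 1%:M 0 (al^-1 *: b^T) 1%:M *m block_mx a b 0 N'.
  rewrite mulmx_block !mul1mx ?mul0mx ?mulmx0 !addr0 aE mul_mx_scalar.
  by rewrite scalerA mulfV // scale1r -scalemxAl /N' addrC subrK.
have psdN' : psd N'.
  split; first by rewrite /N' !raddfB /= linearZ /= trmx_mul trmxK sN.
  move=> w; have := q0 (- al^-1 *: (w *m b^T)) w.
  rewrite qform_block aE mul_mx_scalar scalerA mulrN mulfV //.
  congr (_ <= _).
  have bwT : (w *m b^T)^T = w *m b^T by apply/matrixP=> i j; rewrite mxE !ord1.
  rewrite /N' mulmxBr mulmxBl mulmxDl -?scalemxAr -?scalemxAl -?scalemxAr.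
  rewrite !mulmxA -(mulmxA _ b) (_ : b *m w^T = w *m b^T); last first.
    by rewrite -bwT trmx_mul trmxK.
  rewrite -?scalemxAl !mulmxA.
  set Y := w *m b^T *m w *m b^T; set X := w *m N *m w^T.
  by rewrite !mxE; ring.
have /andP[d0 dle] := IHn _ psdN'.
rewrite E det_mulmx det_lblock det_ublock !det1 !mul1r aE det_scalar1.
rewrite mulr_ge0 //= ler_pM2l // (le_trans dle) //.
apply: ler_prod => i _.
have := (psdN'.2 (delta_mx 0 i)); rewrite -rowE trmx_delta -colE !mxE => ->/=.
rewrite big_ord1 !mxE lerBlDr lerDl -expr2 mulr_ge0 ?invr_ge0 ?sqr_ge0 //.
Qed.

(** Hadamard's inequality after the change of basis that puts [v] in the place of
    the [i0]-th basis vector, whose determinant is [v i0]. A vector [v] on which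
    the quadratic form is small thus makes the determinant small. *)
Lemma det_psd_le_qform (F : realFieldType) n (M : 'M[F]_n) (v : 'rV[F]_n) i0 :
  psd M ->
  (v 0 i0) ^+ 2 * \det M <= (v *m M *m v^T) 0 0 * \prod_(i | i != i0) M i i.
Proof.
move=> pM; pose P := 1%:M + delta_mx i0 (0 : 'I_1) *m (v - delta_mx 0 i0).
have rP i : row i P = if i == i0 then v else delta_mx 0 i.
  rewrite /P raddfD /= row_mul row1 rowE mul_delta_mx_cond.
  case: eqP => [->|_]; last by rewrite mulr0n mul0mx addr0.
  rewrite mulr1n (_ : delta_mx 0 0 = 1%:M) ?mul1mx; first by rewrite addrC subrK.
  by apply/matrixP=> a b; rewrite !mxE !ord1.
have dP : \det P = v 0 i0.
  rewrite /P det_add1_mulmxC -colE det_mx11 !mxE !eqxx /=; ring.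
have /andP[_] := det_psd_bounds (psd_congr P pM).
rewrite !det_mulmx det_tr dP mulrAC -expr2 => /le_trans; apply.
have diagE i : (P *m M *m P^T) i i = (row i P *m M *m (row i P)^T) 0 0.
  rewrite -row_mul [LHS]mxE [RHS]mxE; apply: eq_bigr => j _.
  by rewrite !mxE.
rewrite (bigD1 i0) //= diagE rP eqxx.
suff -> : \prod_(i | i != i0) (P *m M *m P^T) i i = \prod_(i | i != i0) M i i by [].
apply: eq_bigr => i ni0; rewrite diagE rP (negPf ni0).
by rewrite -rowE trmx_delta -colE !mxE.
Qed.

(** * A weighted Cauchy-Binet formula *)

(** The increasing enumeration of a set of given cardinality; at triples it is
    convertible to [nsubset_enum]. *)
Definition subset_enum (T : finType) n (K : {K : {set T} | #|K| == n}) (i : 'I_n) : T :=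
  enum_val (cast_ord (esym (eqP (valP K))) i).

Lemma subset_enum_inj (T : finType) n (K : {K : {set T} | #|K| == n}) :
  injective (subset_enum K).
Proof. by move=> i j /enum_val_inj/cast_ord_inj. Qed.

Lemma subset_enum_in (T : finType) n (K : {K : {set T} | #|K| == n}) i :
  subset_enum K i \in val K.
Proof. exact: enum_valP. Qed.

Lemma subset_enum_onto (T : finType) n (K : {K : {set T} | #|K| == n}) x :
  x \in val K -> exists i, subset_enum K i = x.
Proof.
move=> xK; exists (cast_ord (eqP (valP K)) (enum_rank_in xK x)).
by rewrite /subset_enum cast_ordK enum_rankK_in.
Qed.

Lemma subset_enum_image (T : finType) n (K : {K : {set T} | #|K| == n}) :
  (subset_enum K @: [set: 'I_n] = val K)%SET.
Proof.
apply/setP => x; apply/imsetP/idP => [[i _ ->]|/subset_enum_onto[i <-]].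
  exact: subset_enum_in.
by exists i.
Qed.

(** Expanding each row of the Gram matrix selects a function [f] from row indices
    to [T]; only injective [f] survive, and these are the orderings of the
    [n]-element subsets. *)
Theorem det_weighted_gram (R : comNzRingType) (T : finType) n (w : T -> R)
    (b : T -> 'rV[R]_n) :
  \det (\matrix_(i, j) \sum_x w x * b x 0 i * b x 0 j) =
  \sum_(K : {K : {set T} | #|K| == n}) (\prod_(x in val K) w x) *
     \det (\matrix_(i, j) b (subset_enum K i) 0 j) ^+ 2.
Proof.
pose D (f : 'I_n -> T) := \det (\matrix_(i, j) b (f i) 0 j).
transitivity (\sum_(f : {ffun 'I_n -> T}) (\prod_i (w (f i) * b (f i) 0 i)) * D f).
  rewrite /determinant; under eq_bigr => s _.
    under eq_bigr => i _ do rewrite mxE.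
    rewrite bigA_distr_bigA mulr_sumr /=; over.
  rewrite exchange_big; apply: eq_bigr => f _.
  rewrite /D /determinant mulr_sumr; apply: eq_bigr => s _ /=.
  rewrite big_split /= mulrCA; congr (_ * (_ * _)).
  by apply: eq_bigr => i _; rewrite mxE.
rewrite (bigID (fun f : {ffun 'I_n -> T} => injectiveb f)) /=.
rewrite [X in _ + X]big1 ?addr0 => [|f /injectivePn[i [j ij fij]]]; last first.
  by rewrite /D (determinant_alternate ij) ?mulr0 // => k; rewrite !mxE fij.
pose h (x : {K : {set T} | #|K| == n} * 'S_n) : {ffun 'I_n -> T} :=
  [ffun i => subset_enum x.1 (x.2 i)].
have imh K s : (h (K, s) @: [set: 'I_n] = val K)%SET.
  rewrite -subset_enum_image; apply/setP => x; apply/imsetP/imsetP=> -[i _ ->].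
    by exists (s i) => //; rewrite ffunE.
  by exists ((s^-1)%g i) => //; rewrite ffunE /= permKV.
have h_inj : injective h.
  move=> [K s] [K' s'] e.
  have KK : K = K' by apply: val_inj; rewrite /= -(imh K s) -(imh K' s') e.
  subst K'; congr pair; apply/permP => i; apply: (@subset_enum_inj _ _ K).
  by have /ffunP/(_ i) := e; rewrite !ffunE.
have h_onto (f : {ffun 'I_n -> T}) : injectiveb f = (f \in h @: [set: _])%SET.
  apply/idP/imsetP => [/injectiveP fI|[[K s] _ ->]]; last first.
    by apply/injectiveP => i j; rewrite !ffunE => /subset_enum_inj/perm_inj.
  have cK : #|(f @: [set: 'I_n])%SET| == n.
    by rewrite (card_imset _ fI) cardsT card_ord.
  pose K : {K : {set T} | #|K| == n} := Sub (f @: [set: 'I_n])%SET cK.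
  have fK i : exists j, subset_enum K j == f i.
    by have [|j <-] := @subset_enum_onto _ _ K (f i); [exact: imset_f|exists j].
  have sI : injective (fun i => xchoose (fK i)).
    move=> i j e; apply: fI.
    by rewrite -(eqP (xchooseP (fK i))) -(eqP (xchooseP (fK j))) e.
  exists (K, perm sI) => //; apply/ffunP => i; rewrite ffunE /= permE.
  by rewrite (eqP (xchooseP (fK i))).
under eq_bigl => f do rewrite h_onto.
rewrite big_imset /=; last by move=> x y _ _; exact: h_inj.
rewrite big_set /= -(pair_bigA _ (fun K s =>
  (\prod_i (w (h (K, s) i) * b (h (K, s) i) 0 i)) * D (h (K, s)))) /=.
apply: eq_bigr => K _; rewrite expr2 -{1}det_tr [X in _ * (X * _)]/determinant.
rewrite mulr_suml mulr_sumr; apply: eq_bigr => s _ /=.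
have -> : D (h (K, s)) = (-1) ^+ s * \det (\matrix_(i, j) b (subset_enum K i) 0 j).
  rewrite -det_perm -det_mulmx -row_permE; congr determinant.
  by apply/matrixP => i j; rewrite !mxE ffunE.
rewrite big_split /= -(imh K s) (big_imset w) /=; last first.
  by move=> i j _ _; rewrite !ffunE => /subset_enum_inj/perm_inj.
rewrite big_set /= -mulrA; congr (_ * _).
rewrite !mulrA; congr (_ * _); rewrite mulrC; congr (_ * _).
by apply: eq_bigr => i _; rewrite !mxE ffunE.
Qed.

(** * The Gram matrix of the rows that annihilate a tuple *)

Section Gram.
Variables (R : realFieldType) (G : finZmodType) (n : nat).
Implicit Types (q : {ffun 'I_n -> G}) (a b : G) (i j : 'I_n).

Definition cnt q a : nat := #|[pred i | q i == a]|.

(** When [p] is a probability, this is the law of [- (b + c)] for independent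
    samples [b] and [c] of [p]. *)
Definition negconv (p : G -> R) a : R := \sum_b p b * p (- a - b).

Lemma sum_type q (F : G -> R) : \sum_i F (q i) = \sum_a (cnt q a)%:R * F a.
Proof.
rewrite (partition_big q xpredT) //=; apply: eq_bigr => a _.
rewrite (eq_bigr (fun=> F a)) => [|i /eqP->] //.
by rewrite sumr_const mulr_natl.
Qed.

Lemma prod_type q (F : G -> R) : \prod_i F (q i) = \prod_a F a ^+ cnt q a.
Proof.
rewrite (partition_big q xpredT) //=; apply: eq_bigr => a _.
rewrite (eq_bigr (fun=> F a)) => [|i /eqP->] //.
by rewrite prodr_const.
Qed.

Lemma cntE q a : (cnt q a)%:R = \sum_i (q i == a)%:R :> R.
Proof.
rewrite (sum_type q (fun b => (b == a)%:R)) (bigD1 a) //= eqxx mulr1.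
by rewrite big1 ?addr0 // => b /negPf->; rewrite mulr0.
Qed.

Lemma sum_cnt q : \sum_a (cnt q a)%:R = n%:R :> R.
Proof.
have := sum_type q (fun=> 1); rewrite sumr_const card_ord => ->.
by apply: eq_bigr => a _; rewrite mulr1.
Qed.

Lemma sum_delta (I : finType) (i : I) (F : I -> R) :
  \sum_k (k == i)%:R * F k = F i.
Proof.
rewrite (bigD1 i) //= eqxx mul1r big1 ?addr0 // => k /negPf->.
by rewrite mul0r.
Qed.

Definition zero_sum q : {pred triple n} :=
  fun x => q x.1.1 + q x.1.2 + q x.2 == 0.

Definition real_row (x : triple n) : 'rV[R]_n := map_mx intr (triple_row x).

Definition gram q : 'M[R]_n :=
  \matrix_(i, j) \sum_x (x \in zero_sum q)%:R * real_row x 0 i * real_row x 0 j.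

Lemma real_rowE (x : triple n) i :
  real_row x 0 i = (x.1.1 == i)%:R + (x.1.2 == i)%:R + (x.2 == i)%:R.
Proof.
by rewrite !mxE !eqxx /= ![i == _]eq_sym !rmorphD /=; case: eqP; case: eqP; case: eqP.
Qed.

Lemma sum_triple (F : 'I_n -> 'I_n -> 'I_n -> R) :
  \sum_(x : triple n) F x.1.1 x.1.2 x.2 = \sum_i \sum_j \sum_k F i j k.
Proof.
rewrite -(pair_bigA _ (fun y k => F y.1 y.2 k)) /=.
by rewrite -(pair_bigA _ (fun i j => \sum_k F i j k)).
Qed.

(** In an ordered triple the two marked positions holding [i] and [j] either
    coincide (3 choices) or are distinct (6 choices). *)
Lemma gramE q i j :
  gram q i j = 6 * (cnt q (- q i - q j))%:R
             + (i == j)%:R * (3 * negconv (fun a => (cnt q a)%:R) (q i)).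
Proof.
rewrite mxE; pose t i j k : R := (q i + q j + q k == 0)%:R.
have tC i1 j1 k1 : t i1 j1 k1 = t j1 i1 k1 by rewrite /t [q i1 + _]addrC.
have tA i1 j1 k1 : t i1 j1 k1 = t i1 k1 j1 by rewrite /t addrAC.
have st2 i1 j1 : \sum_k t i1 j1 k = (cnt q (- q i1 - q j1))%:R.
  rewrite cntE; apply: eq_bigr => k _; congr (_%:R); congr (nat_of_bool _).
  by rewrite -opprD -[RHS]subr_eq0 opprK addrC.
have st1 i1 : \sum_j \sum_k t i1 j k = negconv (fun a => (cnt q a)%:R) (q i1).
  under eq_bigr => j1 _ do rewrite st2.
  by rewrite (sum_type q (fun b => (cnt q (- q i1 - b))%:R)).
under eq_bigr => x _ do rewrite !real_rowE.
pose F (a b c : 'I_n) := t a b c * ((a == i)%:R + (b == i)%:R + (c == i)%:R)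
  * ((a == j)%:R + (b == j)%:R + (c == j)%:R).
rewrite (sum_triple F) {}/F.
pose H (a b c : 'I_n) : R := t a b c * ((a == j)%:R + (b == j)%:R + (c == j)%:R).
transitivity (3 * \sum_b \sum_c H i b c).
  transitivity (\sum_a \sum_b \sum_c ((a == i)%:R * H a b c + (b == i)%:R * H a b c
     + (c == i)%:R * H a b c)).
    do 3![apply: eq_bigr => ? _]; rewrite /H; ring.
  under eq_bigr => a _ do
    (under eq_bigr => b _ do rewrite !big_split /= -!mulr_sumr sum_delta).
  under eq_bigr => a _ do rewrite !big_split /= -!mulr_sumr sum_delta.
  rewrite !big_split /= sum_delta.
  have -> : \sum_a \sum_c H a i c = \sum_b \sum_c H i b c.
    by do 2![apply: eq_bigr => ? _]; rewrite /H tC; ring.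
  have -> : \sum_a \sum_b H a b i = \sum_b \sum_c H i b c.
    by do 2![apply: eq_bigr => ? _]; rewrite /H tA tC; ring.
  ring.
have -> : \sum_b \sum_c H i b c = (i == j)%:R * (\sum_b \sum_c t i b c)
   + \sum_c t i j c + \sum_b t i b j.
  transitivity (\sum_b \sum_c ((i == j)%:R * t i b c + (b == j)%:R * t i b c
     + (c == j)%:R * t i b c)).
    do 2![apply: eq_bigr => ? _]; rewrite /H; ring.
  under eq_bigr => b _ do rewrite !big_split /= -!mulr_sumr sum_delta.
  by rewrite !big_split /= -!mulr_sumr sum_delta.
under [X in _ + X]eq_bigr => b _ do rewrite tA.
rewrite st1 st2; ring.
Qed.

Lemma gram_qform q (v : 'rV[R]_n) :
  (v *m gram q *m v^T) 0 0 =
  \sum_(x | x \in zero_sum q) (v 0 x.1.1 + v 0 x.1.2 + v 0 x.2) ^+ 2.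
Proof.
have bE (x : triple n) : \sum_i v 0 i * real_row x 0 i = v 0 x.1.1 + v 0 x.1.2 + v 0 x.2.
  transitivity (\sum_i ((i == x.1.1)%:R * v 0 i + (i == x.1.2)%:R * v 0 i
     + (i == x.2)%:R * v 0 i)).
    apply: eq_bigr => i _; rewrite real_rowE ![i == _]eq_sym; ring.
  by rewrite !big_split /= !sum_delta.
rewrite big_mkcond /= [LHS]mxE.
transitivity (\sum_j \sum_x \sum_i (x \in zero_sum q)%:R * (v 0 i * real_row x 0 i)
   * (v 0 j * real_row x 0 j)).
  apply: eq_bigr => j _; rewrite exchange_big /= mxE mulr_suml; apply: eq_bigr => i _.
  rewrite !mxE mulr_sumr mulr_suml; apply: eq_bigr => x _; ring.
rewrite exchange_big /=; apply: eq_bigr => x _.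
under eq_bigr => j _ do rewrite -mulr_suml -mulr_sumr bE.
rewrite -mulr_sumr bE; case: (x \in _); rewrite ?mul0r // mul1r; ring.
Qed.

Lemma gram_psd q : psd (gram q).
Proof.
split=> [|v]; last by rewrite gram_qform sumr_ge0 // => x _; exact: sqr_ge0.
apply/matrixP => i j; rewrite !mxE; apply: eq_bigr => x _; ring.
Qed.

End Gram.

(** * Subgroups, and Hadamard's bound for the Gram matrix *)

Section Subgroup.
Variables (G : finZmodType) (H : {set G}).
Hypothesis HZ : zmod_closed H.

Lemma zmod_closed_opp a : (- a \in H) = (a \in H).
Proof.
have [H0 HB] := HZ; apply/idP/idP => [Ha|Ha].
  by rewrite -[a]opprK -sub0r HB.
by rewrite -sub0r HB.
Qed.

Lemma zmod_closed_addr a b : b \in H -> (a + b \in H) = (a \in H).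
Proof.
move=> Hb; have [H0 HB] := HZ; apply/idP/idP => [Hab|Ha].
  by rewrite -[a](addrK b) HB.
by rewrite -[b]opprK HB // zmod_closed_opp.
Qed.

Lemma zmod_closed_addl a b : b \in H -> (b + a \in H) = (a \in H).
Proof. by rewrite addrC; exact: zmod_closed_addr. Qed.

Lemma zmod_closed_muln a m : a \in H -> a *+ m \in H.
Proof.
have [H0 HB] := HZ; move=> Ha; elim: m => [|m IHm]; first by rewrite mulr0n.
by rewrite mulrSr zmod_closed_addr.
Qed.

(** Multiplication by [m] is invertible on [G] and preserves [H], so its inverse,
    which is a multiplication as well, preserves [H]. *)
Lemma coprime_muln_closed a m : coprime #|G| m -> (a *+ m \in H) = (a \in H).
Proof.
move=> cop; apply/idP/idP; last exact: zmod_closed_muln.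
have aG : a *+ #|G| = 0.
  apply: (@addIr _ (\sum_(b : G) b)); rewrite add0r [RHS](reindex_inj (addrI a)) /=.
  by rewrite big_split /= sumr_const.
case: (posnP m) => [m0|m0] /(zmod_closed_muln (egcdn m #|G|).1).
  move: cop; rewrite m0 /coprime gcdn0 => /eqP G1 _.
  by rewrite -[a]mulr1n -G1 aG; case: HZ.
case: (egcdnP #|G| m0) => u v e _ /=.
move: cop; rewrite coprime_sym /coprime => /eqP cop.
rewrite -mulrnA mulnC e cop mulrnDr mulr1n.
by rewrite mulnC mulrnA aG mul0rn add0r.
Qed.

End Subgroup.

Section GramBounds.
Variables (R : realType) (G : finZmodType) (n : nat).
Implicit Types (q : {ffun 'I_n -> G}) (a b : G) (i j : 'I_n).

Definition freq q a : R := (cnt q a)%:R / n%:R.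

Lemma sum_freq q : (0 < n)%N -> \sum_a freq q a = 1.
Proof.
by move=> n0; rewrite -mulr_suml sum_cnt divff // pnatr_eq0 -lt0n.
Qed.

Lemma freq_ge0 q a : 0 <= freq q a.
Proof. by rewrite divr_ge0. Qed.

Lemma freq_gt0 q i : 0 < freq q (q i).
Proof.
rewrite divr_gt0 ?ltr0n //; last exact: leq_ltn_trans (ltn_ord i).
by apply/card_gt0P; exists i; rewrite inE.
Qed.

Lemma negconv_cnt q a :
  negconv (fun b => (cnt q b)%:R) a = n%:R ^+ 2 * negconv (freq q) a.
Proof.
case: (posnP n) => [n0|n0].
  have c0 b : cnt q b = 0%N.
    by apply: eq_card0 => i; have := ltn_ord i; rewrite {2}n0.
  by rewrite /negconv !big1 ?mulr0 // => b _; rewrite /freq c0 ?mul0r.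
rewrite mulr_sumr; apply: eq_bigr => b _; rewrite /freq.
have : n%:R != 0 :> R by rewrite pnatr_eq0 -lt0n.
by move=> ?; field.
Qed.

Lemma gramE_freq q i j : gram R q i j =
  6 * n%:R * freq q (- q i - q j) + (i == j)%:R * (3 * n%:R ^+ 2 * negconv (freq q) (q i)).
Proof.
rewrite gramE negconv_cnt mulrA; congr (_ + _); last by ring.
rewrite /freq.
have n0 : n%:R != 0 :> R.
  by rewrite pnatr_eq0 -lt0n; exact: leq_ltn_trans (ltn_ord i).
by field.
Qed.

Lemma negconv_ge0 q a : 0 <= negconv (freq q) a.
Proof. by apply: sumr_ge0 => b _; rewrite mulr_ge0 ?freq_ge0. Qed.

(** Since the triple [(i, i, j)] with [q j = - 2 q i] is one of the many that
    contain [i], the diagonal of the Gram matrix exceeds its main part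
    [3 n^2 negconv (freq q) (q i)] only by a factor [1 + 2 / cnt q (q i)]. *)
Lemma gram_diag_le q i :
  gram R q i i <= 3 * n%:R ^+ 2 * negconv (freq q) (q i) * (1 + 2 / (cnt q (q i))%:R).
Proof.
rewrite gramE_freq eqxx mul1r mulrDr mulr1 addrC lerD2l.
have n0 : n%:R != 0 :> R.
  by rewrite pnatr_eq0 -lt0n; exact: leq_ltn_trans (ltn_ord i).
have c0 : (cnt q (q i))%:R != 0 :> R.
  by rewrite pnatr_eq0 -lt0n; apply/card_gt0P; exists i; rewrite inE.
have -> : 6 * n%:R * freq q (- q i - q i) =
   3 * n%:R ^+ 2 * (freq q (q i) * freq q (- q i - q i)) * (2 / (cnt q (q i))%:R).
  by rewrite {2}/freq; field; rewrite n0 c0.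
rewrite ler_wpM2r ?divr_ge0 // ler_wpM2l ?mulr_ge0 ?exprn_ge0 //.
rewrite /negconv (bigD1 (q i)) //= lerDl sumr_ge0 // => b _.
by rewrite mulr_ge0 ?freq_ge0.
Qed.

Lemma gram_diag_ge0 q i : 0 <= gram R q i i.
Proof.
by rewrite gramE_freq eqxx mul1r addr_ge0 // !mulr_ge0 ?exprn_ge0 ?freq_ge0 ?negconv_ge0.
Qed.

(** Each value [a] contributes [(1 + 2 / cnt q a) ^ cnt q a], which is bounded
    independently of how often it is taken. *)
Lemma prod_gram_diag_le q :
  \prod_i gram R q i i <=
  expR 2 ^+ #|G| * (3 * n%:R ^+ 2) ^+ n * \prod_i negconv (freq q) (q i).
Proof.
apply: (@le_trans _ _ (\prod_i (3 * n%:R ^+ 2 * negconv (freq q) (q i) *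
   (1 + 2 / (cnt q (q i))%:R)))).
  by apply: ler_prod => i _; rewrite gram_diag_ge0 gram_diag_le.
rewrite big_split /= big_split /= prodr_const card_ord.
have P0 : 0 <= \prod_i negconv (freq q) (q i).
  by apply: prodr_ge0 => i _; exact: negconv_ge0.
rewrite -[leRHS]mulrA [leRHS]mulrC ler_wpM2l //.
  by rewrite mulr_ge0 ?exprn_ge0 ?mulr_ge0 ?exprn_ge0.
rewrite (prod_type q (fun a => 1 + 2 / (cnt q a)%:R)) -prodr_const.
apply: ler_prod => a _; rewrite exprn_ge0 ?addr_ge0 ?divr_ge0 //=.
have [->|c0] := posnP (cnt q a); first by rewrite expr0 -expR0 ler_expR.
apply: (@le_trans _ _ (expR (2 / (cnt q a)%:R) ^+ cnt q a)).
  by rewrite lerXn2r ?nnegrE ?addr_ge0 ?divr_ge0 ?expR_ge0 ?expR_ge1Dx.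
by rewrite -expRM_natl mulrC divfK // pnatr_eq0 -lt0n.
Qed.

Lemma det_gram_le q :
  \det (gram R q) <= 
  expR 2 ^+ #|G| * (3 * n%:R ^+ 2) ^+ n * \prod_i negconv (freq q) (q i).
Proof.
have /andP[_ /le_trans] := det_psd_bounds (gram_psd R q); apply.
exact: prod_gram_diag_le.
Qed.

Lemma det_gram_ge0 q : 0 <= \det (gram R q).
Proof. by have /andP[] := det_psd_bounds (gram_psd R q). Qed.

End GramBounds.

(** * Near-degeneracy of the Gram matrix at a proper subgroup *)

Section Escape.
Variables (R : realType) (G : finZmodType) (n : nat) (H : {set G}).
Hypotheses (HZ : zmod_closed H) (odd_G : coprime #|G| 2).
Implicit Types (q : {ffun 'I_n -> G}) (i j : 'I_n).

Definition escape q : nat := #|[pred i | q i \notin H]|.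

(** The test vector is 1 on the coset of [a0 = q i0], [- 1] on the opposite coset
    and 0 elsewhere. A triple summing to 0 cannot have exactly one value outside
    [H]; if it has exactly two, these lie in opposite cosets and cancel. So only
    the triples with three values outside [H] see the vector, and each
    contributes at most [3 ^ 2]. *)
Lemma det_gram_escape q i0 : q i0 \notin H ->
  \det (gram R q) <= 9 * (escape q)%:R ^+ 3 * \prod_(i | i != i0) gram R q i i.
Proof.
move=> qi0; have [H0 HB] := HZ; set a0 := q i0 in qi0.
pose v : 'rV[R]_n := \row_i ((q i - a0 \in H)%:R - (q i + a0 \in H)%:R).
(* This is where [#|G|] odd matters: [2 a0] in [H] would put [a0] in [H]. *)
have vi0 : v 0 i0 = 1.
  rewrite mxE -/a0 subrr H0 -mulr2n coprime_muln_closed // (negPf qi0).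
  by rewrite subr0.
have := det_psd_le_qform v i0 (gram_psd R q).
rewrite vi0 expr1n mul1r => /le_trans; apply.
rewrite ler_wpM2r //; first by apply: prodr_ge0 => i _; exact: gram_diag_ge0.
have vH i : q i \in H -> v 0 i = 0.
  move=> qi; rewrite mxE !zmod_closed_addl // zmod_closed_opp // (negPf qi0).
  by rewrite subrr.
have vbound i : -1 <= v 0 i <= 1.
  by rewrite mxE; do 2![case: (_ \in H) => /=]; lra.
have vopp i j : q i + q j \in H -> v 0 i + v 0 j = 0.
  move=> qij; rewrite !mxE.
  have -> : (q i - a0 \in H) = (q j + a0 \in H).
    rewrite -[LHS]zmod_closed_opp // -(zmod_closed_addr HZ (- (q i - a0)) qij) opprB.
    by rewrite addrA subrK addrC.
  have -> : (q i + a0 \in H) = (q j - a0 \in H).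
    rewrite -[LHS]zmod_closed_opp // -(zmod_closed_addr HZ (- (q i + a0)) qij) opprD.
    by rewrite [- q i - a0]addrC addrA subrK addrC.
  lra.
rewrite gram_qform.
pose S := [pred i | q i \notin H].
have zero (x : triple n) : x \in zero_sum q ->
    ~~ [&& x.1.1 \in S, x.1.2 \in S & x.2 \in S] -> v 0 x.1.1 + v 0 x.1.2 + v 0 x.2 = 0.
  case: x => [[x1 x2] x3]; rewrite !inE /zero_sum unfold_in /= => /eqP E.
  rewrite !negb_and !negbK => /or3P[] h.
  - rewrite (vH _ h) add0r vopp //.
    by rewrite -(zmod_closed_addl HZ _ h) addrA E.
  - rewrite (vH _ h) addr0 vopp //.
    by rewrite -(zmod_closed_addl HZ _ h) addrA [q x2 + _]addrC E.
  - rewrite (vH _ h) addr0 vopp //.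
    by rewrite -(zmod_closed_addr HZ _ h) E.
pose S3 : {set triple n} := finset.setX (finset.setX [set i in S] [set i in S]) [set i in S].
have cS3 : #|S3| = (escape q ^ 3)%N.
  by rewrite !cardsX !cardsE /escape !expnS expn0 muln1 mulnA.
rewrite -natrX -cS3 mulr_natr -sumr_const [leRHS]big_mkcond [leLHS]big_mkcond /=.
apply: ler_sum => -[[x1 x2] x3] _; case: ifP => xr; last by case: ifP.
have -> : ((x1, x2, x3) \in S3) = [&& x1 \in S, x2 \in S & x3 \in S].
  by rewrite !finset.in_setX !finset.in_set andbA.
case: ifPn => xS /=; last first.
  by rewrite (zero (x1, x2, x3)) // expr0n.
have /andP[? ?] := vbound x1; have /andP[? ?] := vbound x2; have /andP[? ?] := vbound x3; nra.
Qed.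
End Escape.

(** * The moment as a sum over generating tuples *)

Section Moment.
Variables (R : realType) (G : finZmodType) (n : nat).
Implicit Types (q : {ffun 'I_n -> G}) (a b : G) (i j : 'I_n).

(** Conjugation by the diagonal matrix of the values of [negconv (freq q)] turns
    this into the stochastic matrix whose row [s] is the law of [b] given that
    [- b - c = s], for independent samples [b] and [c] of [freq q]. *)
Definition transition q : 'M[R]_#|G| :=
  \matrix_(s, t) (freq R q (enum_val t) * freq R q (- enum_val s - enum_val t)
                  / negconv (freq R q) (enum_val t)).

(** The Gram matrix is an invertible diagonal matrix plus a product through the
    [#|G|]-dimensional space of functions on [G], so that [det_add1_mulmxC] brings
    its determinant down to dimension [#|G|]. *)
Lemma det_gram_transition q : (forall i, negconv (freq R q) (q i) != 0) ->
  \det (gram R q) = (3 * n%:R ^+ 2) ^+ n * (\prod_i negconv (freq R q) (q i)) *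
    \det (1%:M + 2 *: transition q).
Proof.
move=> p0; pose d i := 3 * n%:R ^+ 2 * negconv (freq R q) (q i).
have n0 (i : 'I_n) : n%:R != 0 :> R.
  by rewrite pnatr_eq0 -lt0n; exact: leq_ltn_trans (ltn_ord i).
have d0 i : d i != 0 by rewrite !mulf_neq0 ?expf_neq0 ?n0.
pose A : 'M[R]_(n, #|G|) := \matrix_(i, s) ((q i == enum_val s)%:R / d i).
pose B : 'M[R]_(#|G|, n) := \matrix_(s, j) (6 * n%:R * freq R q (- enum_val s - q j)).
have sum_val (F : G -> R) : \sum_(s < #|G|) F (enum_val s) = \sum_a F a.
  by rewrite [RHS](reindex (@enum_val _ G)) //; apply: onW_bij; exact: enum_val_bij.
have gramM : gram R q = diag_mx (\row_i d i) *m (1%:M + A *m B).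
  apply/matrixP => i j; rewrite gramE_freq mul_diag_mx !mxE mulrDr addrC.
  congr (_ + _); first by rewrite mulrC; case: eqP.
  under eq_bigr => s _ do rewrite !mxE.
  rewrite (sum_val (fun a => (q i == a)%:R / d i * (6 * n%:R * freq R q (- a - q j)))).
  rewrite (bigD1 (q i)) //= big1 ?addr0 => [|a]; last first.
    by rewrite eq_sym => /negPf->; rewrite !mul0r.
  by rewrite eqxx /= [RHS]mulrA mul1r mulfV ?d0 // mul1r.
rewrite gramM det_mulmx det_diag det_add1_mulmxC.
congr (_ * _).
  rewrite -[n in _ ^+ n]card_ord -prodr_const -big_split /=.
  by apply: eq_bigr => i _; rewrite mxE.
congr (\det (_ + _)); apply/matrixP => s t; rewrite !mxE.
under eq_bigr => j _ do rewrite !mxE.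
rewrite (sum_type q (fun b => 6 * n%:R * freq R q (- enum_val s - b) *
   ((b == enum_val t)%:R / (3 * n%:R ^+ 2 * negconv (freq R q) b)))).
rewrite (bigD1 (enum_val t)) //= big1 ?addr0 => [|a /negPf->]; last first.
  by rewrite mul0r !mulr0.
rewrite eqxx /= {3}/freq; case: (posnP (cnt q (enum_val t))) => [->|c0].
  by rewrite !mul0r mulr0.
have /card_gt0P[i] := c0; rewrite inE => /eqP qi.
have := p0 i; rewrite qi /= => pt; have nn := n0 i.
by field; rewrite nn pt.
Qed.

Definition generates q : bool :=
  `[< forall y, exists v : 'rV[int]_n, \sum_j q j *~ v 0 j = y >].

Lemma zmod_closed_mulz (H : {set G}) a (z : int) : zmod_closed H -> a \in H -> a *~ z \in H.
Proof.
move=> HZ Ha; case: z => m; first by rewrite -pmulrn zmod_closed_muln.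
by rewrite NegzE mulrNz zmod_closed_opp // -pmulrn zmod_closed_muln.
Qed.

(** A generating tuple has a value outside each proper subgroup. *)
Lemma generates_sub q (H : {set G}) :
  zmod_closed H -> generates q -> (forall i, q i \in H) -> H = [set: G]%SET.
Proof.
move=> HZ /asboolP gq qH; apply/setP => y; rewrite !inE.
have [v <-] := gq y; elim/big_rec: _ => [|i x _ xH]; first by case: HZ.
by rewrite zmod_closed_addr // zmod_closed_mulz.
Qed.

Lemma generates_onto q : (forall a, exists i, q i = a) -> generates q.
Proof.
move=> onto; apply/asboolP => y; have [i <-] := onto y.
exists (delta_mx 0 i); rewrite (bigD1 i) //= mxE !eqxx /= mulr1z.
by rewrite big1 ?addr0 // => j /negPf ji; rewrite mxE eqxx eq_sym [i == j]eq_sym ji.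
Qed.

Definition kills (A : 'M[int]_n) q : bool :=
  [forall i, \sum_j q j *~ A i j == 0].

(** A homomorphism from a cokernel is the choice of an image for each basis
    vector, subject to the relations given by the rows. *)
Lemma nb_Sur_cok (A : 'M[int]_n) :
  nb_Sur (cok A) G = #|[pred q | kills A q && generates q]|.
Proof.
pose Q := Quotient.quot (row_lattice A).
pose pi (v : 'rV[int]_n) : cok A := (\pi_Q v)%qT.
have piB : {morph pi : v w / v - w}.
  move=> v w; rewrite /pi (_ : (\pi_Q (v - w))%qT = (\pi_Q v - \pi_Q w)%qT) //.
  by rewrite !piE.
have piK (c : cok A) : pi (repr (c : Q)) = c by rewrite /pi reprK.
pose hom q (v : 'rV[int]_n) := \sum_j q j *~ v 0 j.
have homB q : {morph hom q : v w / v - w}.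
  move=> v w; rewrite /hom -sumrB; apply: eq_bigr => j _.
  by rewrite !mxE mulrzBr.
have hom_lattice q v : kills A q -> v \in row_lattice A -> hom q v = 0.
  move=> /forallP kq /asboolP[u ->]; rewrite /hom.
  transitivity (\sum_j \sum_i (q j *~ A i j) *~ u 0 i).
    apply: eq_bigr => j _; rewrite mxE mulrz_sumr; apply: eq_bigr => i _.
    by rewrite mulrzA_C.
  rewrite exchange_big big1 // => i _.
  by rewrite -mulrz_suml (eqP (kq i)) mul0rz.
have hom_pi q v w : kills A q -> (\pi_Q v = \pi_Q w)%qT -> hom q v = hom q w.
  move=> kq /eqP; rewrite -Quotient.idealrBE => /(hom_lattice q _ kq).
  by rewrite homB => /eqP; rewrite subr_eq0 => /eqP.
pose lift q (c : cok A) : G := hom q (repr (c : Q)).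
have liftE q v : kills A q -> lift q (pi v) = hom q v.
  by move=> kq; apply: hom_pi => //; rewrite reprK.
have lift_inj : {in [pred q | kills A q && generates q] &, injective lift}.
  move=> q q' /andP[kq _] /andP[kq' _] e; apply/ffunP => i.
  have := congr1 (fun f => f (pi (delta_mx 0 i))) e.
  have homd p : hom p (delta_mx 0 i) = p i.
    rewrite /hom (bigD1 i) //= mxE !eqxx mulr1z big1 ?addr0 // => j /negPf ji.
    by rewrite mxE ji andbF mulr0z.
  by rewrite !liftE // !homd.
rewrite /nb_Sur (_ : fset_set _ =
    [fset lift q | q in [pred q | kills A q && generates q]]%fset).
  by rewrite card_in_imfset //= -cardE.
apply/fsetP => f; rewrite in_fset_set; last exact: finite_Sur_cok.
apply/idP/imfsetP => [/set_mem[fB fS]|[q /andP[kq /asboolP gq] ->]]; last first.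
  apply/mem_set; split => [x y|y].
    rewrite -[x]piK -[y]piK -piB.
    by rewrite !liftE // homB.
  have [v <-] := gq y; exists (pi v); exact: liftE.
pose F : {additive cok A -> G} := HB.pack f (GRing.isZmodMorphism.Build _ _ _ fB).
pose P : {additive 'rV[int]_n -> cok A} := HB.pack pi (GRing.isZmodMorphism.Build _ _ pi piB).
pose q := [ffun i => F (P (delta_mx 0 i))].
have homE v : hom q v = F (P v).
  rewrite [v in RHS]row_sum_delta !raddf_sum; apply: eq_bigr => j _.
  by rewrite ffunE -[in RHS](intz (v 0 j)) scaler_int !raddfMz.
have liftq c : lift q c = f c by rewrite -[in RHS](piK c) -[RHS]/(F (P _)) -homE.
exists q; last by apply/funext => c; rewrite liftq.
apply/andP; split.
  apply/forallP => i; apply/eqP.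
  transitivity (hom q (row i A)); first by apply: eq_bigr => j _; rewrite mxE.
  rewrite homE (_ : P _ = 0) ?raddf0 //.
  have <- : P 0 = 0 by rewrite raddf0.
  apply/eqP; rewrite /= /pi -(Quotient.idealrBE (row_lattice A)) subr0.
  by apply/asboolP; exists (delta_mx 0 i); rewrite -rowE.
apply/asboolP => y; have [c <-] := fS y; exists (repr (c : Q)).
by rewrite -liftq.
Qed.

Lemma sqr_det_Bsub (K : nsubset n) :
  (`|\det (Bsub K)| ^+ 2)%:~R =
  \det (\matrix_(i, j) real_row R (subset_enum K i) 0 j) ^+ 2.
Proof.
rewrite real_normK ?num_real // rmorphXn /= -det_map_mx; congr (\det _ ^+ 2).
by apply/matrixP => i j; rewrite !mxE enum_rankK.
Qed.

Lemma det_Bmx_gram_real :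
  (\det ((Bmx n)^T *m Bmx n))%:~R = \det (gram R ([ffun=> 0] : {ffun 'I_n -> G})).
Proof.
rewrite det_Bmx_gram rmorph_sum /= det_weighted_gram.
apply: eq_bigr => K _; rewrite sqr_det_Bsub big1 ?mul1r // => x _.
by rewrite /zero_sum unfold_in !ffunE !addr0 eqxx.
Qed.

(** The probability that all selected rows annihilate [q] is a ratio of
    determinants, by Cauchy-Binet with weight 1 on these rows and 0 elsewhere. *)
Theorem expect_nb_Sur :
  expect (R := R) (fun K : nsubset n => (nb_Sur (cok (Bsub K)) G)%:R) =
  \sum_(q | generates q) \det (gram R q) / \det (gram R ([ffun=> 0] : {ffun 'I_n -> G})).
Proof.
have nbE (K : nsubset n) : (nb_Sur (cok (Bsub K)) G)%:R =
    \sum_(q | generates q) \prod_(x in val K) (x \in zero_sum q)%:R :> R.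
  rewrite nb_Sur_cok -sum1_card natr_sum big_mkcond [RHS]big_mkcond /=.
  apply: eq_bigr => q _; rewrite inE andbC; case: (generates q) => //=.
  have killsE : kills (Bsub K) q = [forall x in val K, x \in zero_sum q].
    have rowE' i : \sum_j q j *~ Bsub K i j =
        q (nsubset_enum K i).1.1 + q (nsubset_enum K i).1.2 + q (nsubset_enum K i).2.
      have sd (k : 'I_n) : \sum_j q j *~ (delta_mx 0 k : 'rV[int]_n) 0 j = q k.
        rewrite (bigD1 k) //= mxE !eqxx mulr1z big1 ?addr0 // => j /negPf jk.
        by rewrite mxE jk andbF mulr0z.
      rewrite -!sd -!big_split /=; apply: eq_bigr => j _.
      by rewrite -!mulrzDr !mxE enum_rankK.
    apply/forallP/forallP => [h x|h i].
      apply/implyP => /(@subset_enum_onto _ _ K)[i <-].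
      by have := h i; rewrite rowE'.
    rewrite rowE'; have /implyP := h (nsubset_enum K i); apply.
    exact: (@subset_enum_in _ _ K i).
  rewrite killsE; case: (boolP [forall x in val K, _]) => [/forall_inP h|].
    by rewrite big1 // => x xK; rewrite h.
  rewrite negb_forall_in => /exists_inP[x xK /negPf xr].
  by rewrite (bigD1 x) //= xr mul0r.
rewrite /expect; under eq_bigr => K _ do rewrite nbE mulr_sumr.
rewrite exchange_big; apply: eq_bigr => q _ /=.
rewrite det_weighted_gram mulr_suml; apply: eq_bigr => K _.
by rewrite /law sqr_det_Bsub det_Bmx_gram_real mulrC mulrA.
Qed.

(** At the zero tuple the Gram matrix is [3 n^2] times the identity plus a matrix
    of rank one, which triples the determinant. *)
Lemma det_gram0 : (0 < n)%N ->
  \det (gram R ([ffun=> 0] : {ffun 'I_n -> G})) = 3 * (3 * n%:R ^+ 2) ^+ n.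
Proof.
move=> n0; set q := [ffun=> 0].
have nn : n%:R != 0 :> R by rewrite pnatr_eq0 -lt0n.
have f0 : freq R q 0 = 1.
  rewrite /freq /cnt (eq_card (B := predT)) ?card_ord ?divff // => i.
  by rewrite !inE ffunE eqxx.
have c0 : negconv (freq R q) 0 = 1.
  rewrite /negconv (bigD1 0) //= big1 ?addr0 => [|a a0].
    by rewrite oppr0 addr0 f0 mulr1.
  suff -> : freq R q a = 0 by rewrite mul0r.
  rewrite /freq /cnt eq_card0 ?mul0r // => i; rewrite !inE ffunE eq_sym.
  exact: negPf.
have -> : gram R q = (3 * n%:R ^+ 2) *:
    (1%:M + (const_mx 1 : 'cV_n) *m (const_mx (2 / n%:R) : 'rV_n)).
  apply/matrixP => i j; rewrite gramE_freq !mxE big_ord1 !mxE !ffunE oppr0 addr0 f0 c0.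
  by case: (i == j); rewrite ?mulr1n ?mulr0n; field.
rewrite detZ det_add1_mulmxC det_mx11 !mxE eqxx mulr1n.
under eq_bigr => i _ do rewrite !mxE mulr1.
rewrite sumr_const card_ord -(mulr_natr (2 / _)) divfK // mulrC; congr (_ * _); lra.
Qed.

End Moment.

(** * Stability of the equation satisfied by limiting types *)

Section Stability.
Variables (R : realFieldType) (G : finZmodType).
Implicit Types (H : {set G}) (a b : G) (nu : G -> R).

(** Convolution with the uniform measure of [H]. *)
Definition coset_mean H (f : G -> R) a : R := (\sum_(b in H) f (a + b)) / #|H|%:R.

Definition uniform H a : R := (a \in H)%:R / #|H|%:R.

Lemma max_exists (f : G -> R) : exists a, forall b, f b <= f a.
Proof. by case: (@arg_maxP _ R G 0 xpredT f isT) => a _ h; exists a => b; exact: h. Qed.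

Section Linearize.
Variables (H : {set G}) (HZ : zmod_closed H) (nu : G -> R).
Let d a := nu a - uniform H a.

Lemma card_zmod_closed_gt0 : 0 < #|H|%:R :> R.
Proof. by rewrite ltr0n; apply/card_gt0P; exists 0; case: HZ. Qed.

Lemma mean_const (x : R) : (\sum_(b in H) x) / #|H|%:R = x.
Proof.
by rewrite sumr_const -[x *+ _]mulr_natr mulfK // gt_eqF // card_zmod_closed_gt0.
Qed.

Lemma sum_uniform : \sum_a uniform H a = 1.
Proof.
rewrite -mulr_suml (eq_bigr (fun a => if a \in H then 1 else 0)) => [|a _].
  by rewrite -big_mkcond sumr_const divff // gt_eqF // card_zmod_closed_gt0.
by case: (a \in H).
Qed.

(** The map [nu |-> negconv nu] linearized at the uniform measure of [H]: the
    linear term only sees the masses of the cosets of [H]. *)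
Lemma negconv_near_uniform a :
  negconv nu a = uniform H a + 2 * coset_mean H d (- a) + negconv d a.
Proof.
have h0 := card_zmod_closed_gt0.
have uE (f : G -> R) : \sum_b uniform H b * f b = (\sum_(b in H) f b) / #|H|%:R.
  rewrite mulr_suml [RHS]big_mkcond; apply: eq_bigr => b _.
  by rewrite /uniform; case: (b \in H); rewrite ?mul0r // mul1r mulrC.
have mE (f : G -> R) : \sum_b uniform H b * f (- a - b) = coset_mean H f (- a).
  rewrite uE /coset_mean; congr (_ / _).
  rewrite (reindex_inj oppr_inj) /=; apply: eq_big => b; last by rewrite opprK.
  by rewrite zmod_closed_opp.
rewrite /negconv.
transitivity (\sum_b (uniform H b * uniform H (- a - b) + uniform H b * d (- a - b)
   + uniform H (- a - b) * d b + d b * d (- a - b))).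
  by apply: eq_bigr => b _; rewrite /d; ring.
rewrite !big_split /= !mE.
have -> : \sum_b uniform H (- a - b) * d b = coset_mean H d (- a).
  rewrite -mE (reindex_inj (@subrI _ (- a))) /=.
  by apply: eq_bigr => b _; rewrite subKr.
have -> : coset_mean H (uniform H) (- a) = uniform H a.
  rewrite /coset_mean /uniform (eq_bigr (fun=> (a \in H)%:R / #|H|%:R)) => [|b bH].
    exact: mean_const.
  by rewrite zmod_closed_addr // zmod_closed_opp.
ring.
Qed.

Lemma coset_mean_addr f a b : b \in H -> coset_mean H f (a + b) = coset_mean H f a.
Proof.
move=> bH; rewrite /coset_mean; congr (_ / _).
rewrite [RHS](reindex_inj (addrI b)) /=; apply: eq_big => c.
  by rewrite zmod_closed_addl.
by rewrite addrA.
Qed.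

Lemma coset_mean_idem f a : coset_mean H (coset_mean H f) a = coset_mean H f a.
Proof.
rewrite [LHS]/coset_mean (eq_bigr (fun=> coset_mean H f a)) => [|b bH].
  exact: mean_const.
exact: coset_mean_addr.
Qed.

Lemma coset_mean_opp f a : coset_mean H (fun b => f (- b)) a = coset_mean H f (- a).
Proof.
rewrite /coset_mean; congr (_ / _).
rewrite [RHS](reindex_inj oppr_inj) /=; apply: eq_big => b; last by rewrite opprD.
by rewrite zmod_closed_opp.
Qed.

Lemma coset_mean_bound f (x : R) a : (forall b, `|f b| <= x) -> `|coset_mean H f a| <= x.
Proof.
move=> fx; have h0 := card_zmod_closed_gt0.
rewrite normrM normfV [X in _ / X]gtr0_norm // ler_pdivrMr //.
rewrite (le_trans (ler_norm_sum _ _ _)) // (le_trans (ler_sum _ (fun b _ => fx (a + b)))) //.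
by rewrite sumr_const mulr_natr.
Qed.

Lemma negconv_bound (f : G -> R) (x : R) a : (forall b, `|f b| <= x) ->
  `|negconv f a| <= #|G|%:R * x ^+ 2.
Proof.
move=> fx; rewrite (le_trans (ler_norm_sum _ _ _)) //.
apply: (@le_trans _ _ (\sum_(b : G) x ^+ 2)); last by rewrite sumr_const mulr_natl.
by apply: ler_sum => b _; rewrite normrM expr2 ler_pM.
Qed.

(** The linear part [d a - 2 (coset mean of d at - a)] is invertible because the
    coset means satisfy [e a - 2 e (- a) = small], whose matrix on the pair
    [(e a, e (- a))] has determinant [1 - 4]. *)
Lemma stability_bootstrap (t : R) :
  (forall a, `|nu a - negconv nu a| <= t) ->
  (forall a, `|d a| <= (6 * #|G|%:R)^-1) -> forall a, `|d a| <= 6 * t.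
Proof.
move=> hnu hd.
have [m hm] := max_exists (fun a => `|d a|).
suff : `|d m| <= 6 * t by move=> h a; exact: le_trans (hm a) h.
set D : R := `|d m| in hm *; pose X := t + #|G|%:R * D ^+ 2.
have linE a : `|d a - 2 * coset_mean H d (- a)| <= X.
  have -> : d a - 2 * coset_mean H d (- a) = (nu a - negconv nu a) + negconv d a.
    by rewrite negconv_near_uniform /d; ring.
  by rewrite (le_trans (ler_normD _ _)) // lerD // negconv_bound.
have meanE a : `|coset_mean H d a - 2 * coset_mean H d (- a)| <= X.
  have -> : coset_mean H d a - 2 * coset_mean H d (- a) =
      coset_mean H (fun b => d b - 2 * coset_mean H d (- b)) a.
    rewrite [RHS]/coset_mean sumrB mulrBl -mulr_sumr -mulrA -/(coset_mean _ _ a).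
    congr (_ - 2 * _); rewrite -/(coset_mean H (fun b => coset_mean H d (- b)) a).
    by rewrite coset_mean_opp coset_mean_idem.
  exact: coset_mean_bound.
have eX a : `|coset_mean H d a| <= X.
  have := meanE a; have := meanE (- a); rewrite opprK !ler_norml.
  by move=> /andP[? ?] /andP[? ?]; apply/andP; split; lra.
have g1 : 1 <= #|G|%:R :> R by rewrite ler1n; apply/card_gt0P; exists 0.
have D6 : #|G|%:R * (D * 6) <= 1.
  have g6 : 0 < 6 * #|G|%:R :> R by lra.
  by have := hd m; rewrite -/D -(ler_pM2l g6) mulfV ?gt_eqF //; lra.
have : D <= 3 * X.
  have := linE m; have := eX (- m); rewrite /D !ler_norml.
  by move=> /andP[? ?] /andP[? ?]; apply/andP; split; lra.
have : 0 <= D by exact: normr_ge0.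
rewrite /X; nra.
Qed.

End Linearize.

(** At an exact solution [nu = negconv nu], let [M] be the maximum of [nu] and [a] a
    point where it is attained. Then [M] is an average of the values
    [nu (- a - b)] with weights [nu b], hence [nu (- a - b) = M] for all [b] in the
    support. Counting, the support is the set where [nu] equals [M], and it is
    stable under [(a, b) |-> - a - b]; such a set is a coset [m + K] of a subgroup
    with [3 m] in [K], hence equals [K] when 3 is invertible. The proof follows
    this with errors of order [s], the set [B] of the points of measure at least
    [s] playing the role of the support; [stability_bootstrap] then improves the
    error to order [s ^ 2]. *)
Theorem stability nu (s : R) :
  coprime #|G| 6 -> (forall a, 0 <= nu a) -> \sum_a nu a = 1 ->
  0 < s -> 12 * #|G|%:R ^+ 2 * s <= 1 ->
  (forall a, `|nu a - negconv nu a| <= s ^+ 2) ->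
  exists2 H : {set G}, zmod_closed H & forall a, `|nu a - uniform H a| <= 6 * s ^+ 2.
Proof.
move=> cop nu0 nu1 s0 sG hnu.
have cop3 : coprime #|G| 3 by move: cop; rewrite -[6%N]/(2 * 3)%N coprimeMr => /andP[].
have g1 : 1 <= #|G|%:R :> R by rewrite ler1n; apply/card_gt0P; exists 0.
set g : R := #|G|%:R in g1 sG.
have gs : g * s <= 12^-1 by nra.
have ggs : g * (g * s) <= 12^-1 by nra.
have s12 : s <= 12^-1 by nra.
have [m hm] := max_exists nu; set M := nu m in hm.
have gM : 1 <= g * M.
  rewrite -nu1 /g mulr_natl -sumr_const; exact: ler_sum.
have M1 : M <= 1.
  by rewrite -nu1 (bigD1 m) //= lerDl sumr_ge0.
(* One term of the average over [c] of [M - nu (- a - c)]. *)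
have deficit a b : nu b * (M - nu (- a - b)) <= M - nu a + s ^+ 2.
  have E : \sum_c nu c * (M - nu (- a - c)) = M - negconv nu a.
    by under eq_bigr do rewrite mulrBr; rewrite sumrB -mulr_suml nu1 mul1r.
  apply: (@le_trans _ _ (M - negconv nu a)).
    rewrite -E (bigD1 b) //= lerDl sumr_ge0 // => c _.
    by rewrite mulr_ge0 // subr_ge0.
  have := hnu a; rewrite ler_norml => /andP[? ?]; lra.
have Ms : 5 * g * s <= M.
  have g0 : 0 < g by lra.
  rewrite -(ler_pM2l g0); lra.
pose B := [set a | s <= nu a]%SET; pose B' := [set a | M - s <= nu a]%SET.
have sBB' : B' \subset B.
  apply/fintype.subsetP => a; rewrite !inE => h; apply: le_trans h; nra.
have BB' : B = B'.
  apply/eqP; rewrite eq_sym eqEcard sBB' /=.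
  rewrite -(card_imset _ (@subrI _ (- m))); apply: subset_leq_card.
  apply/fintype.subsetP => _ /imsetP[b + ->]; rewrite !inE => sb.
  have := deficit m b; rewrite -/M; nra.
have high a : a \in B -> M - s <= nu a by rewrite BB' inE.
have Bop a b : a \in B -> b \in B -> - a - b \in B.
  move=> aB bB; rewrite inE.
  have := deficit a b; have := high a aB; have := high b bB.
  rewrite leNgt => hb ha dab; apply/negP => ys.
  have sM : 5 * s <= M by nra.
  have M2 : 5 * s <= M * M by nra.
  have : (4 / 5 * M) * (4 / 5 * M) <= nu b * (M - nu (- a - b)).
    by apply: ler_pM; lra.
  have : s ^+ 2 <= s / 12 by rewrite expr2 ler_wpM2l //; lra.
  lra.
have mB : m \in B by rewrite BB' inE -/M; lra.
have B3 a b c : a \in B -> b \in B -> c \in B -> a + b - c \in B.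
  by move=> aB bB cB; have := Bop _ _ (Bop _ _ aB bB) cB; rewrite opprB opprK [b + a]addrC.
pose B0 := [set a | a + m \in B]%SET.
have B0E a : (a \in B0) = (a + m \in B) by rewrite finset.in_set.
have B0Z : zmod_closed B0.
  split=> [|a b]; first by rewrite B0E add0r.
  rewrite !B0E => aB bB; have := B3 _ _ _ aB mB bB.
  by rewrite opprD addrACA subrr addr0 addrAC.
(* [- 2 m] lies in [B = m + B0], hence [3 m] lies in the subgroup [B0]. *)
have m0 : m \in B0.
  rewrite -(coprime_muln_closed B0Z m cop3) -(zmod_closed_opp B0Z) B0E.
  by rewrite mulrS opprD addrAC addNr add0r mulr2n opprD Bop.
have B00 : 0 \in B.
  by move: m0; rewrite -(zmod_closed_opp B0Z) B0E addNr.
have BZ : zmod_closed B.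
  by split=> // a b aB bB; have := B3 _ _ _ aB B00 bB; rewrite addr0.
exists B => //; apply: stability_bootstrap => // a.
have h0 := card_zmod_closed_gt0 BZ.
set h : R := #|B|%:R in h0 *.
have h1 : 1 <= h by rewrite ler1n -(ltr0n R).
have sumB : \sum_(b in B) nu b + \sum_(b in ~: B) nu b = 1.
  by rewrite -nu1 [RHS](bigID (mem B)) /=; congr (_ + _); apply: eq_bigl => b; rewrite inE.
have up : h * M + g * s >= 1.
  rewrite -sumB lerD //.
    by rewrite mulr_natl -sumr_const; exact: ler_sum.
  apply: (@le_trans _ _ (\sum_(b in ~: B) s)).
    by apply: ler_sum => b; rewrite !inE -ltNge => /ltW.
  rewrite sumr_const -mulr_natl ler_wpM2r //; first exact: ltW.
  by rewrite ler_nat max_card.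
have lo : h * (M - s) <= 1.
  rewrite -sumB (le_trans _ (_ : \sum_(b in B) nu b <= _)) ?lerDl ?sumr_ge0 //.
  rewrite mulr_natl -sumr_const; apply: ler_sum => b; exact: high.
have gV : 2 * g * s <= (6 * g)^-1.
  rewrite -[leRHS]mul1r ler_pdivlMr; last by lra.
  by move: ggs; lra.
rewrite -/g /uniform -/h.
have hVp : 0 < h^-1 by rewrite invr_gt0.
have hV1 : h^-1 <= 1 by rewrite invf_le1.
have hK x : h^-1 * (h * x) = x by rewrite mulKf ?gt_eqF.
have up' : h^-1 <= M + g * s.
  have := ler_wpM2l (ltW hVp) up; rewrite mulr1 mulrDr hK => /le_trans; apply.
  by rewrite lerD2l ler_piMl //; nra.
have lo' : M - s <= h^-1.
  by have := ler_wpM2l (ltW hVp) lo; rewrite mulr1 hK.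
case: (boolP (a \in B)) => aB.
  have := high a aB; have := hm a; rewrite mul1r => h2 h3.
  rewrite ler_norml; apply/andP; split; nra.
have := nu0 a; move: aB; rewrite inE -ltNge => nas na0.
rewrite mul0r subr0 ger0_norm //; nra.
Qed.
End Stability.

(** * Entropy bounds *)

Section ExpBounds.
Variable R : realType.

(** The inequality [x <= exp (x - 1)], applied to each factor, replaces both the
    concavity of the logarithm and Stirling's formula in what follows. *)
Lemma prod_le_expR (I : finType) (F : I -> R) : (forall i, 0 <= F i) ->
  \prod_i F i <= expR (\sum_i (F i - 1)).
Proof.
move=> F0; rewrite expR_sum; apply: ler_prod => i _; rewrite F0 /=.
by have := expR_ge1Dx (F i - 1); rewrite addrC subrK.
Qed.

Lemma prod_ge_expR (I : finType) (F : I -> R) : (forall i, 0 < F i) ->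
  expR (\sum_i (1 - (F i)^-1)) <= \prod_i F i.
Proof.
move=> F0.
have h : \prod_i (F i)^-1 <= expR (\sum_i ((F i)^-1 - 1)).
  by apply: prod_le_expR => i; rewrite invr_ge0 ltW.
have P0 : 0 < \prod_i F i by apply: prodr_gt0 => i _; exact: F0.
rewrite -lef_pV2 ?posrE ?expR_gt0 // -expRN -sumrN -prodfV.
by rewrite (eq_bigr _ (fun i _ => opprB 1 (F i)^-1)).
Qed.

Lemma sum_prod_ffun (G : finType) n (w : G -> R) :
  \sum_(q : {ffun 'I_n -> G}) \prod_i w (q i) = (\sum_a w a) ^+ n.
Proof. by rewrite -(bigA_distr_bigA (fun _ => w)) prodr_const card_ord. Qed.

(** A weight [w] that depends on [q] only through a class [cl q] still has total
    mass at most one on each class. *)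
Lemma sum_class_le (G T : finType) n (cl : {ffun 'I_n -> G} -> T)
    (w : T -> G -> R) (c : T -> R) :
  (forall t a, 0 <= w t a) -> (forall q, \sum_a w (cl q) a <= 1) ->
  (forall t, 0 <= c t) ->
  \sum_q c (cl q) * \prod_i w (cl q) (q i) <= \sum_t c t.
Proof.
move=> w0 w1 c0; rewrite (partition_big cl xpredT) //=; apply: ler_sum => t _.
case: (pickP (fun q => cl q == t)) => [q /eqP qt|none]; last first.
  by rewrite big_pred0.
rewrite (eq_bigr (fun q' : {ffun 'I_n -> G} => c t * \prod_i w t (q' i)));
  last by move=> q' /eqP->.
rewrite -mulr_sumr ler_piMr //.
apply: (@le_trans _ _ (\sum_(q : {ffun 'I_n -> G}) \prod_i w t (q i))).
  rewrite [leRHS](bigID (fun q => cl q == t)) /= lerDl.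
  by rewrite sumr_ge0 // => q' _; rewrite prodr_ge0.
by rewrite sum_prod_ffun exprn_ile1 ?sumr_ge0 // -qt.
Qed.

End ExpBounds.

Section Types.
Variables (R : realType) (G : finZmodType) (n : nat).
Implicit Types (q : {ffun 'I_n -> G}) (p : G -> R).

(** The exponent is the squared Hellinger distance between [p] and the empirical
    distribution of [q]: apply [prod_le_expR] to the square roots of the ratios
    [p (q i) / freq q (q i)]. *)
Lemma prod_le_hellinger q p : (0 < n)%N -> (forall a, 0 <= p a) -> \sum_a p a = 1 ->
  \prod_i p (q i) <=
  expR (- n%:R * \sum_a (Num.sqrt (freq R q a) - Num.sqrt (p a)) ^+ 2)
    * \prod_i freq R q (q i).
Proof.
move=> n0 p0 p1.
have nn : n%:R != 0 :> R by rewrite pnatr_eq0 -lt0n.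
pose nu := freq R q; pose y a : R := Num.sqrt (p a / nu a).
have y2 i : p (q i) = y (q i) ^+ 2 * nu (q i).
  by rewrite sqr_sqrtr ?divr_ge0 ?freq_ge0 // divfK // gt_eqF // freq_gt0.
have -> : \prod_i p (q i) = (\prod_i y (q i)) ^+ 2 * \prod_i nu (q i).
  by rewrite -prodrXl -big_split /=; apply: eq_bigr => i _; rewrite -y2.
rewrite ler_wpM2r //; first by apply: prodr_ge0 => i _; exact: freq_ge0.
have y0 : 0 <= \prod_i y (q i) by apply: prodr_ge0 => i _; exact: sqrtr_ge0.
have := prod_le_expR (fun i => sqrtr_ge0 (p (q i) / nu (q i))).
rewrite -/(\prod_i y (q i)) => yle.
apply: (@le_trans _ _ (expR (\sum_i (y (q i) - 1)) ^+ 2)).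
  by rewrite lerXn2r ?nnegrE ?expR_ge0.
rewrite -expRM_natl ler_expR sumrB sumr_const card_ord.
rewrite (sum_type q y).
have ny a : (cnt q a)%:R * y a <= n%:R * (Num.sqrt (nu a) * Num.sqrt (p a)).
  have [c0|c0] := eqVneq (cnt q a) 0%N.
    by rewrite c0 mul0r; apply: mulr_ge0 => //; apply: mulr_ge0; exact: sqrtr_ge0.
  have nua : 0 < nu a by rewrite /nu /freq divr_gt0 ?ltr0n // lt0n.
  have yE : y a = Num.sqrt (p a) / Num.sqrt (nu a).
    by rewrite /y sqrtrM // sqrtrV // ltW.
  have cE : (cnt q a)%:R = n%:R * Num.sqrt (nu a) ^+ 2 :> R.
    by rewrite sqr_sqrtr ?(ltW nua) // mulrC divfK.
  have s0 : Num.sqrt (nu a) != 0 by rewrite gt_eqF // sqrtr_gt0.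
  by rewrite cE yE le_eqVlt; apply/orP; left; apply/eqP; field.
have hel : \sum_a (Num.sqrt (nu a) - Num.sqrt (p a)) ^+ 2 =
    2 - 2 * \sum_a Num.sqrt (nu a) * Num.sqrt (p a).
  transitivity (\sum_a (nu a + p a - 2 * (Num.sqrt (nu a) * Num.sqrt (p a)))).
    apply: eq_bigr => a _; rewrite sqrrB !sqr_sqrtr ?freq_ge0 //; ring.
  by rewrite sumrB big_split /= p1 sum_freq // mulr_sumr.
rewrite hel mulNr mulrBr.
have : \sum_a (cnt q a)%:R * y a <= n%:R * \sum_a Num.sqrt (nu a) * Num.sqrt (p a).
  by rewrite mulr_sumr; exact: ler_sum.
nra.
Qed.

(** A single discrepancy bounds the Hellinger distance from below, because
    [u - v = (sqrt u - sqrt v) * (sqrt u + sqrt v)] and the last factor is at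
    most 2. *)
Lemma prod_le_far q p a t : (0 < n)%N -> (forall a, 0 <= p a) -> \sum_a p a = 1 ->
  0 <= t -> t <= `|freq R q a - p a| ->
  \prod_i p (q i) <= expR (- n%:R * t ^+ 2 / 4) * \prod_i freq R q (q i).
Proof.
move=> n0 p0 p1 t0 ta; apply: le_trans (prod_le_hellinger q n0 p0 p1) _.
rewrite ler_wpM2r //; first by apply: prodr_ge0 => i _; exact: freq_ge0.
rewrite ler_expR -mulrA !mulNr lerN2 ler_wpM2l //.
rewrite (bigD1 a) //= -[leLHS]addr0 lerD ?sumr_ge0 // => [|b _]; last exact: sqr_ge0.
set u := Num.sqrt (freq R q a); set v := Num.sqrt (p a).
have u2 : u ^+ 2 = freq R q a by rewrite sqr_sqrtr // freq_ge0.
have v2 : v ^+ 2 = p a by rewrite sqr_sqrtr.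
have u0 : 0 <= u := sqrtr_ge0 _. have v0 : 0 <= v := sqrtr_ge0 _.
have u1 : u <= 1.
  rewrite -[leRHS]sqrtr1 ler_sqrt // -(sum_freq R q) // (bigD1 a) //=.
  by rewrite lerDl sumr_ge0 // => b _; exact: freq_ge0.
have v1 : v <= 1.
  rewrite -[leRHS]sqrtr1 ler_sqrt // -p1 (bigD1 a) //=.
  by rewrite lerDl sumr_ge0.
rewrite ler_pdivrMr //.
apply: (@le_trans _ _ (`|freq R q a - p a| ^+ 2)); first by rewrite lerXn2r ?nnegrE.
rewrite real_normK ?num_real // -u2 -v2.
have -> : (u ^+ 2 - v ^+ 2) ^+ 2 = (u - v) ^+ 2 * (u + v) ^+ 2 by ring.
rewrite ler_wpM2l ?sqr_ge0 //; nra.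
Qed.

(** Tuples with the same counts have total mass at most one under the product of
    their common distribution, and there are at most [n.+1 ^ #|G|] counts. *)
Lemma sum_prod_freq_le (P : pred {ffun 'I_n -> G}) : (0 < n)%N ->
  \sum_(q | P q) \prod_i freq R q (q i) <= n.+1%:R ^+ #|G|.
Proof.
move=> n0.
pose cl q : {ffun G -> 'I_n.+1} := [ffun a => inord (cnt q a)].
pose w (f : {ffun G -> 'I_n.+1}) a : R := (f a)%:R / n%:R.
have clE q a : cl q a = cnt q a :> nat.
  by rewrite ffunE inordK // ltnS -[n in (_ <= n)%N]card_ord max_card.
have wE q a : w (cl q) a = freq R q a by rewrite /w clE.
have := @sum_class_le R G _ n cl w (fun=> 1).
rewrite sumr_const card_ffun card_ord natrX => h.
apply: le_trans (h _ _ _) => [|t a|q|t]; last by [].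
- rewrite [leLHS]big_mkcond; apply: ler_sum => q _; rewrite mul1r.
  under [leRHS]eq_bigr do rewrite wE.
  by case: ifP => // _; apply: prodr_ge0 => i _; exact: freq_ge0.
- by rewrite divr_ge0.
- by under eq_bigr do rewrite wE; rewrite sum_freq.
Qed.

End Types.

(** * Products near the uniform measure of a subgroup *)

Lemma sum_negconv_pred (R : comNzRingType) (G : finZmodType) (P : pred G) (nu : G -> R) :
  \sum_(a | P a) \sum_b nu b * nu (- a - b) =
  \sum_b \sum_c (P (- b - c))%:R * (nu b * nu c).
Proof.
rewrite exchange_big /=; apply: eq_bigr => b _.
rewrite big_mkcond (reindex_inj (@subrI _ (- b))) /=; apply: eq_bigr => c _.
have -> : - (- b - c) - b = c by rewrite opprB opprK addrK.
by case: (P _); rewrite ?mul1r ?mul0r.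
Qed.

Section NearUniform.
Variables (R : realType) (G : finZmodType) (n : nat) (H : {set G}).
Hypotheses (HZ : zmod_closed H) (n0 : (0 < n)%N).
Implicit Types (q : {ffun 'I_n -> G}) (a b : G).

Local Notation g := (#|G|%:R).
Local Notation h := (#|H|%:R).
Local Notation nu := (freq R).
Local Notation p q := (negconv (freq R q)).

Let nn : n%:R != 0 :> R.
Proof. by rewrite pnatr_eq0 -lt0n. Qed.

Lemma sum_negconv_freq q : \sum_a p q a = 1.
Proof.
rewrite /negconv (sum_negconv_pred xpredT).
under eq_bigr do (under eq_bigr do rewrite mul1r; rewrite -mulr_sumr sum_freq // mulr1).
exact: sum_freq.
Qed.

Definition escape_rate q : R := (escape H q)%:R / n%:R.
Local Notation kappa := escape_rate.

Lemma escape_rateE q : kappa q = \sum_(a | a \notin H) nu q a.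
Proof.
rewrite -mulr_suml /kappa; congr (_ / _).
rewrite /escape -sum1_card natr_sum big_mkcond /=.
rewrite (eq_bigr (fun i => (fun a => (a \notin H)%:R) (q i))); last first.
  by move=> i _; rewrite inE; case: (q i \in H).
rewrite (sum_type q (fun a => (a \notin H)%:R)) [RHS]big_mkcond /=.
by apply: eq_bigr => a _; case: (a \in H); rewrite ?mulr0 ?mulr1.
Qed.

Lemma sum_freq_in q : \sum_(a in H) nu q a = 1 - kappa q.
Proof.
by rewrite escape_rateE -(sum_freq R q n0) [\sum_a _](bigID (mem H)) /= addrK.
Qed.

Lemma escape_rate_ge0 q : 0 <= kappa q.
Proof. by rewrite divr_ge0. Qed.

Definition out_mass q : R := \sum_(a | a \notin H) p q a.
Definition out_mass_supp q : R := \sum_(a | (a \notin H) && (0 < cnt q a)%N) p q a.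

Lemma out_mass_supp_le q : out_mass_supp q <= out_mass q.
Proof.
rewrite [leRHS](bigID (fun a => (0 < cnt q a)%N)) /= lerDl sumr_ge0 // => a _.
exact: negconv_ge0.
Qed.

(** If exactly one of [b] and [c] lies in [H] then [- b - c] does not. *)
Lemma out_mass_ge q : 2 * kappa q * (1 - kappa q) <= out_mass q.
Proof.
rewrite /out_mass /negconv sum_negconv_pred.
have -> : 2 * kappa q * (1 - kappa q) = \sum_b \sum_c
   ((b \in H)%:R * (c \notin H)%:R + (b \notin H)%:R * (c \in H)%:R) * (nu q b * nu q c).
  have inE' : 1 - kappa q = \sum_b (b \in H)%:R * nu q b.
    rewrite -sum_freq_in big_mkcond; apply: eq_bigr => b _.
    by case: (b \in H); rewrite ?mul1r ?mul0r.
  have outE : kappa q = \sum_b (b \notin H)%:R * nu q b.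
    rewrite escape_rateE big_mkcond; apply: eq_bigr => b _.
    by case: (b \in H); rewrite ?mul1r ?mul0r.
  transitivity (\sum_b ((b \in H)%:R * nu q b * kappa q +
      (b \notin H)%:R * nu q b * (1 - kappa q))).
    rewrite big_split /= -!mulr_suml -inE' -outE; ring.
  apply: eq_bigr => b _; rewrite {1}outE inE' !mulr_sumr -big_split /=.
  by apply: eq_bigr => c _; ring.
apply: ler_sum => b _; apply: ler_sum => c _.
rewrite ler_wpM2r ?mulr_ge0 ?freq_ge0 //.
case: (boolP (b \in H)) => bH; case: (boolP (c \in H)) => cH /=;
  rewrite ?mul0r ?mulr0 ?mul1r ?add0r ?addr0 ?mulr1 //.
  by rewrite zmod_closed_addl ?zmod_closed_opp // (negPf cH).
by rewrite zmod_closed_addr ?zmod_closed_opp // (negPf bH).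
Qed.

(** Without two values outside [H] whose sum lies in [H], each pair [(b, c)] that
    contributes has both [b] and [c] outside [H]: if [b] lay in [H], then
    [- b - c] and [c] would be two such values. *)
Lemma out_mass_supp_small q :
  (forall i j, q i \notin H -> q j \notin H -> q i + q j \notin H) ->
  out_mass_supp q <= kappa q ^+ 2.
Proof.
move=> sumfree; rewrite /out_mass_supp /negconv sum_negconv_pred.
have -> : kappa q ^+ 2 = \sum_b \sum_c ((b \notin H) && (c \notin H))%:R * (nu q b * nu q c).
  rewrite expr2 escape_rateE mulr_suml big_mkcond; apply: eq_bigr => b _ /=.
  case: ifP => bH /=; last by rewrite big1 // => c _; rewrite mul0r.
  rewrite mulr_sumr big_mkcond; apply: eq_bigr => c _.
  by case: ifP; rewrite ?mul1r ?mul0r.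
apply: ler_sum => b _; apply: ler_sum => c _.
have supp a : nu q a != 0 -> exists i, q i = a.
  rewrite /freq mulf_eq0 invr_eq0 (negPf nn) orbF pnatr_eq0 -lt0n => /card_gt0P[i].
  by rewrite inE => /eqP; exists i.
have [->|/supp[i qi]] := eqVneq (nu q b) 0; first by rewrite !mul0r !mulr0.
have [->|/supp[j qj]] := eqVneq (nu q c) 0; first by rewrite !mulr0.
rewrite ler_wpM2r ?mulr_ge0 ?freq_ge0 // ler_nat -qi -qj.
case: (boolP (_ && (0 < _)%N)) => // /andP[aH /card_gt0P[k]].
rewrite inE => /eqP qk; rewrite lt0b.
apply/andP; split; apply/negP => inH.
  have jH : q j \notin H by move: aH; rewrite zmod_closed_addl ?zmod_closed_opp.
  have := sumfree k j; rewrite qk subrK zmod_closed_opp // inH /=.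
  by move=> /(_ aH jH).
have iH : q i \notin H by move: aH; rewrite zmod_closed_addr ?zmod_closed_opp.
have := sumfree k i; rewrite qk addrAC addNr add0r zmod_closed_opp // inH /=.
by move=> /(_ aH iH).
Qed.

(** The law of [q i] when only the frequencies outside [H] are prescribed: it
    keeps these and is flat on [H]. The product of its copies has total mass at
    most 1 on the tuples with these prescribed frequencies, so no multinomial
    coefficient has to be estimated. *)
Definition near_weight q a : R := if a \in H then (1 - kappa q) / h else nu q a.

Lemma sum_near_weight q : \sum_a near_weight q a = 1.
Proof.
rewrite (bigID (mem H)) /= (eq_bigr (fun=> (1 - kappa q) / h)); last first.
  by move=> a aH; rewrite /near_weight aH.
rewrite -mulr_suml mean_const // [X in _ + X](eq_bigr (nu q)); last first.
  by move=> a aH; rewrite /near_weight (negPf aH).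
by rewrite -escape_rateE subrK.
Qed.

Section Fixed.
Variables (q : {ffun 'I_n -> G}) (eta : R).
Hypothesis near : forall a, `|nu q a - uniform R H a| <= eta.
Hypothesis small : 8 * g * eta <= 1.

Let g1 : 1 <= g :> R.
Proof. by rewrite ler1n; apply/card_gt0P; exists 0. Qed.
Let h0 : 0 < h :> R := card_zmod_closed_gt0 R HZ.
Let hg : h <= g :> R.
Proof. by rewrite ler_nat max_card. Qed.
Let eta0 : 0 <= eta.
Proof. exact: le_trans (normr_ge0 _) (near 0). Qed.

Lemma escape_rate_le : kappa q <= g * eta.
Proof.
rewrite escape_rateE; apply: (@le_trans _ _ (\sum_(a | a \notin H) eta)).
  apply: ler_sum => a aH; apply: le_trans (near a).
  by rewrite /uniform (negPf aH) mul0r subr0 ler_norm.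
rewrite sumr_const -[leLHS]mulr_natl ler_wpM2r // ler_nat; exact: max_card.
Qed.

Lemma escape_rate_le8 : kappa q <= 8^-1.
Proof. have := escape_rate_le; have := small; lra. Qed.

(** On [H] the measure [negconv (freq q)] is constant up to second order, so its
    correlation with the first-order fluctuations of [freq q] is of third order. *)
Lemma in_correlation :
  h / (1 - kappa q) * \sum_(a in H) nu q a * p q a <=
  \sum_(a in H) p q a + 4 * g ^+ 3 * eta ^+ 3.
Proof.
have k8 := escape_rate_le8; have kg := escape_rate_le; have k0 := escape_rate_ge0 q.
pose d a := nu q a - uniform R H a.
pose e a := h / (1 - kappa q) * nu q a - 1.
have k1 : 1 - kappa q != 0 by rewrite gt_eqF //; lra.
have hn : h != 0 :> R by rewrite gt_eqF.
have sum_e : \sum_(a in H) e a = 0.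
  rewrite sumrB -mulr_sumr sum_freq_in sumr_const; rewrite divfK //; exact: subrr.
rewrite mulr_sumr -lerBlDl -sumrB.
have -> : \sum_(a in H) (h / (1 - kappa q) * (nu q a * p q a) - p q a) =
   \sum_(a in H) e a * negconv d a.
  pose A := h^-1 + 2 * coset_mean H d 0.
  transitivity (\sum_(a in H) (e a * A + e a * negconv d a)).
    apply: eq_bigr => a aH; rewrite (negconv_near_uniform HZ (nu q) a) /e /A.
    rewrite -[- a]add0r coset_mean_addr ?zmod_closed_opp // /uniform aH mul1r.
    ring.
  by rewrite big_split /= -mulr_suml sum_e mul0r add0r.
apply: le_trans (ler_norm _) _; apply: le_trans (ler_norm_sum _ _ _) _.
apply: (@le_trans _ _ (\sum_(a in H) 4 * g * eta * (g * eta ^+ 2))).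
  apply: ler_sum => a aH; rewrite normrM; apply: ler_pM => //; last first.
    exact: negconv_bound.
  have -> : e a = (h * d a + kappa q) / (1 - kappa q).
    rewrite /e /d /uniform aH /=; field; by rewrite k1 hn.
  rewrite normrM normfV [X in _ / X]gtr0_norm; last by lra.
  rewrite ler_pdivrMr; last by lra.
  rewrite (le_trans (ler_normD _ _)) // normrM (ger0_norm (ltW h0)) (ger0_norm k0).
  have hd : h * `|d a| <= g * eta by apply: ler_pM => //; exact: near.
  have ge0 : 0 <= g * eta by apply: mulr_ge0.
  rewrite -(mulrA 4 g eta); move: (g * eta) hd ge0 kg => x; nra.
rewrite sumr_const -[leLHS]mulr_natl.
have -> : 4 * g ^+ 3 * eta ^+ 3 = g * (4 * g * eta * (g * eta ^+ 2)) by ring.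
by rewrite ler_wpM2r // !mulr_ge0 ?exprn_ge0.
Qed.

(** [prod_le_expR] applied to the ratios [p q (q i) / near_weight q (q i)], divided
    by [lambda] at the [i] with [q i] outside [H]. A good [lambda] is the typical
    size of these last ratios: 2 in general, since an element outside [H] can be
    reached by drawing the element outside [H] first or second. *)
Lemma near_prod (lambda : R) : 0 < lambda ->
  \prod_i p q (q i) <= lambda ^+ escape H q *
    expR (n%:R * (out_mass_supp q / lambda - out_mass q + 4 * g ^+ 3 * eta ^+ 3)) *
    \prod_i near_weight q (q i).
Proof.
move=> l0; have k8 := escape_rate_le8; have k0 := escape_rate_ge0 q.
pose lam a := if a \in H then 1 else lambda.
have lam0 a : 0 < lam a by rewrite /lam; case: ifP.
have w0 i : 0 < near_weight q (q i).
  rewrite /near_weight; case: ifP => _; last exact: freq_gt0.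
  by rewrite divr_gt0 //; lra.
pose y a := p q a / near_weight q a / lam a.
have y0 i : 0 <= y (q i).
  by apply: divr_ge0; [apply: divr_ge0; [exact: negconv_ge0|exact: ltW]|exact: ltW].
have -> : \prod_i p q (q i) =
    lambda ^+ escape H q * (\prod_i y (q i)) * \prod_i near_weight q (q i).
  have -> : lambda ^+ escape H q = \prod_i lam (q i).
    rewrite (bigID (fun i => q i \in H)) /= big1 ?mul1r => [|i qi]; last by rewrite /lam qi.
    rewrite (eq_bigr (fun=> lambda)) ?prodr_const // => i qi.
    by rewrite /lam (negPf qi).
  rewrite -!big_split /=; apply: eq_bigr => i _; rewrite /y.
  by field; rewrite !gt_eqF.
rewrite ler_wpM2r //; first by apply: prodr_ge0 => i _; exact: ltW.
rewrite ler_wpM2l //; first by apply/exprn_ge0/ltW.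
apply: le_trans (prod_le_expR y0) _; rewrite ler_expR.
rewrite sumrB sumr_const card_ord (sum_type q y) (bigID (mem H)) /=.
have Hpart : \sum_(a in H) (cnt q a)%:R * y a <=
    n%:R * (\sum_(a in H) p q a + 4 * g ^+ 3 * eta ^+ 3).
  apply: le_trans (ler_wpM2l _ in_correlation) => //; rewrite mulr_sumr mulr_sumr.
  rewrite le_eqVlt; apply/orP; left; apply/eqP; apply: eq_bigr => a aH.
  rewrite /y /lam /near_weight aH /freq; field.
  by rewrite nn gt_eqF ?gt_eqF //; lra.
have outpart : \sum_(a | a \notin H) (cnt q a)%:R * y a = n%:R * (out_mass_supp q / lambda).
  rewrite /out_mass_supp big_mkcondr /= mulr_suml mulr_sumr; apply: eq_bigr => a aH.
  case: (posnP (cnt q a)) => [->|c0]; first by rewrite !mul0r mulr0.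
  rewrite /y /lam /near_weight (negPf aH) /freq; field.
  by rewrite nn pnatr_eq0 -lt0n c0 gt_eqF.
have : \sum_(a in H) p q a = 1 - out_mass q.
  by rewrite -(sum_negconv_freq q) [\sum_a _](bigID (mem H)) /= addrK.
move=> inE'; move: Hpart; rewrite outpart inE'.
move: (\sum_(_ in H) _) (n%:R : R) (out_mass q) (_ / lambda) (4 * _ * _) => S N o x c.
by move=> hS; apply: (@le_trans _ _ (N * (1 - o + c) + N * x - N)); [rewrite !lerD2r | lra].
Qed.

End Fixed.
End NearUniform.

(** * Terms near a proper subgroup *)

Section MomentTerm.
Variables (R : realType) (G : finZmodType) (n : nat).
Hypothesis n0 : (0 < n)%N.
Implicit Types (q : {ffun 'I_n -> G}) (a b : G).
Local Notation g := (#|G|%:R).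
Local Notation p q := (negconv (freq R q)).

(** The contribution of [q] to the moment, by [det_gram0]. *)
Definition moment_term q : R := \det (gram R q) / (3 * (3 * n%:R ^+ 2) ^+ n).

Let N := (3 * n%:R ^+ 2) ^+ n : R.
Let N0 : 0 < N.
Proof. by rewrite exprn_gt0 // mulr_gt0 // exprn_gt0 // ltr0n. Qed.

Lemma moment_term_ge0 q : 0 <= moment_term q.
Proof. by rewrite divr_ge0 ?det_gram_ge0 // mulr_ge0 // ltW. Qed.

Lemma moment_term_le q : moment_term q <= expR 2 ^+ #|G| / 3 * \prod_i p q (q i).
Proof.
rewrite ler_pdivrMr; last by rewrite mulr_gt0.
apply: le_trans (det_gram_le R q) _; rewrite -/N le_eqVlt; apply/orP; left.
by apply/eqP; field.
Qed.

Lemma two_le_expR : 2 <= expR (3 / 4) :> R.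
Proof.
(* [1 + 3 / 4] is too small, but [(1 + 3 / 32) ^ 8] exceeds 2. *)
have -> : 3 / 4 = 8%:R * (3 / 32) :> R by lra.
rewrite expRM_natl; apply: (@le_trans _ _ ((35 / 32) ^+ 8)); first by lra.
by rewrite lerXn2r ?nnegrE ?expR_ge0 //; have := expR_ge1Dx (3 / 32 : R); lra.
Qed.

Section Near.
Variables (H : {set G}) (q : {ffun 'I_n -> G}) (eta : R).
Hypotheses (HZ : zmod_closed H) (odd_G : coprime #|G| 2).
Hypotheses (near : forall a, `|freq R q a - uniform R H a| <= eta)
  (small : 8 * g * eta <= 1) (small3 : n%:R * eta ^+ 3 <= 1)
  (esc : (0 < escape H q)%N).
Local Notation k := (escape H q).
Local Notation kappa := (escape_rate R H q).
Local Notation E := (expR (4 * g ^+ 3)).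
Local Notation W := (\prod_i near_weight R H q (q i)).

Let k0 : 0 <= kappa.
Proof. exact: escape_rate_ge0. Qed.
Let k8 : kappa <= 8^-1.
Proof. exact: escape_rate_le8 near small. Qed.
Let nk : n%:R * kappa = k%:R.
Proof. by rewrite mulrC divfK // pnatr_eq0 -lt0n. Qed.
Let W0 : 0 <= W.
Proof.
apply: prodr_ge0 => i _; rewrite /near_weight; case: ifP => _; last exact: freq_ge0.
by rewrite divr_ge0 //; have := k8; lra.
Qed.
Let g1 : 1 <= g :> R.
Proof. by rewrite ler1n; apply/card_gt0P; exists 0. Qed.

Lemma expR_third_order x : n%:R * (x + 4 * g ^+ 3 * eta ^+ 3) <= n%:R * x + 4 * g ^+ 3.
Proof.
by rewrite mulrDr lerD2l mulrCA ler_piMr.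
Qed.

(** [near_prod] with [lambda = 2] bounds the ratio by [(2 / e) ^ k] up to lower
    order terms, and [2 < e] leaves room for [exp (- k / 8)]. *)
Lemma near_prod_pair :
  \prod_i p q (q i) <= expR (- k%:R / 8) * E * W.
Proof.
apply: le_trans (near_prod HZ n0 near small (ltr0n R 2)) _.
rewrite ler_wpM2r // -expRD.
apply: (@le_trans _ _ (expR (3 / 4) ^+ k * expR (- k%:R * (1 - kappa) + 4 * g ^+ 3))).
  apply: ler_pM; rewrite ?exprn_ge0 ?expR_ge0 //.
    by rewrite lerXn2r ?nnegrE ?expR_ge0 ?two_le_expR.
  rewrite ler_expR; apply: le_trans (expR_third_order _) _; rewrite lerD2r.
  have le1 := out_mass_supp_le R H q; have le2 := out_mass_ge R HZ n0 q.
  rewrite -nk mulNr -mulrA -mulrN ler_wpM2l //.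
  move: le1 le2; rewrite -[2 * kappa * _]mulrA; move: (kappa * _) => y; lra.
rewrite -expRM_natl -expRD ler_expR.
have kk : k%:R * kappa <= k%:R * 8^-1 by rewrite ler_wpM2l.
move: kk; rewrite mulrBr mulr1 !mulNr; move: (k%:R * kappa) (k%:R : R) => x y; lra.
Qed.

(** If no two values outside [H] have their sum in [H], elements outside [H] are
    only reached from two values outside [H]; so [lambda = kappa] is the right
    scale in [near_prod], and the ratio gains the factor [kappa ^ k]. *)
Lemma near_prod_sumfree :
  (forall i j, q i \notin H -> q j \notin H -> q i + q j \notin H) ->
  \prod_i p q (q i) <= 8 * kappa * expR (- k%:R / 8) * E * W.
Proof.
have k8' := k8; move=> sumfree; have kp : 0 < kappa by rewrite divr_gt0 ?ltr0n.
apply: le_trans (near_prod HZ n0 near small kp) _.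
rewrite ler_wpM2r //; apply: ler_pM; rewrite ?exprn_ge0 ?expR_ge0 //.
  have -> : - k%:R / 8 = k%:R * (- 8^-1) :> R by lra.
  rewrite expRM_natl -(prednK esc) !exprS.
  set e := expR _; set m := (escape H q).-1.
  have -> : 8 * kappa * (e * e ^+ m) = kappa * (8 * e * e ^+ m) by ring.
  apply: ler_wpM2l => //; rewrite -[leLHS]mul1r.
  have e8 : 7 / 8 <= e by rewrite /e; have := expR_ge1Dx (- 8^-1 : R); lra.
  apply: ler_pM; rewrite ?exprn_ge0 //; first by lra.
  by rewrite lerXn2r ?nnegrE ?expR_ge0 //; lra.
rewrite ler_expR; apply: le_trans (expR_third_order _) _.
rewrite gerDr mulr_ge0_le0 //.
have le1 : out_mass_supp R H q / kappa <= kappa.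
  by rewrite ler_pdivrMr // -expr2; exact: out_mass_supp_small.
have le2 := out_mass_ge R HZ n0 q; nra.
Qed.

(** If [q i0] and [q j] lie outside [H] and their sum in [H], then
    [q i0 + q j + q l = 0] for about [n / #|H|] indices [l], so the diagonal entry at
    [i0] has order [n] and [det_gram_escape] gains [k^3 / n] over Hadamard's bound.
    If there is no such pair, [near_prod_sumfree] already gains [k / n]. *)
Theorem near_term_le :
  moment_term q <= 3 * g * expR 2 ^+ #|G| * E * (k%:R ^+ 3 / n%:R) * expR (- k%:R / 8) * W.
Proof.
have g1' := g1; have small' := small; have k1 : 1 <= k%:R :> R by rewrite ler1n.
have nn : 0 < n%:R :> R by rewrite ltr0n.
have C0 : 0 <= expR 2 ^+ #|G| :> R by rewrite exprn_ge0 ?expR_ge0.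
have E0 : 0 <= E :> R by exact: expR_ge0.
have e0 : 0 <= expR (- k%:R / 8) :> R by exact: expR_ge0.
case: (boolP [exists i, exists j, [&& q i \notin H, q j \notin H & q i + q j \in H]]);
  last first.
  move=> none; apply: le_trans (moment_term_le q) _.
  have sumfree i j : q i \notin H -> q j \notin H -> q i + q j \notin H.
    move=> iH jH; apply: contra none => ijH; apply/existsP; exists i.
    by apply/existsP; exists j; apply/and3P.
  apply: le_trans (ler_wpM2l _ (near_prod_sumfree sumfree)) _; first by rewrite divr_ge0.
  rewrite /escape_rate.
  have -> : expR 2 ^+ #|G| / 3 * (8 * (k%:R / n%:R) * expR (- k%:R / 8) * E * W) =
    (8 / 3 * k%:R) * (expR 2 ^+ #|G| * E * n%:R^-1 * expR (- k%:R / 8) * W)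
    by field; exact: lt0r_neq0.
  have -> : 3 * g * expR 2 ^+ #|G| * E * (k%:R ^+ 3 / n%:R) * expR (- k%:R / 8) * W =
    (3 * g * k%:R ^+ 3) * (expR 2 ^+ #|G| * E * n%:R^-1 * expR (- k%:R / 8) * W)
    by field; exact: lt0r_neq0.
  rewrite ler_wpM2r ?mulr_ge0 ?invr_ge0 //.
  have : k%:R <= g * k%:R ^+ 3 :> R.
    rewrite -[leLHS]mul1r; by apply: ler_pM => //; exact: ler_eXnr.
  rewrite -(mulrA 3); move: (k%:R : R) k1 => x; move: (g * _) => y; lra.
case/existsP => i0 /existsP[j /and3P[iH jH ijH]].
have diag : 3 * n%:R / (2 * g) <= gram R q i0 i0.
  rewrite gramE_freq eqxx mul1r.
  have pge : (n%:R)^-1 * (2 * g)^-1 <= p q (q i0).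
    apply: (@le_trans _ _ (freq R q (q j) * freq R q (- q i0 - q j))); last first.
      rewrite /negconv (bigD1 (q j)) //= lerDl sumr_ge0 // => b _.
      by rewrite mulr_ge0 ?freq_ge0.
    apply: ler_pM; rewrite ?invr_ge0 ?mulr_ge0 //.
      rewrite /freq -[leLHS]mul1r ler_wpM2r ?invr_ge0 // ler1n.
      by apply/card_gt0P; exists j; rewrite inE.
    have bH : - q i0 - q j \in H by rewrite -opprD zmod_closed_opp.
    have := near (- q i0 - q j); rewrite /uniform bH mul1r ler_norml => /andP[nb _].
    have h0 : 0 < #|H|%:R :> R := card_zmod_closed_gt0 R HZ.
    have hV : g^-1 <= #|H|%:R^-1 :> R.
      by rewrite lef_pV2 ?posrE ?ler_nat ?max_card //; lra.
    have gV : g * g^-1 = 1 :> R by rewrite mulfV // gt_eqF //; lra.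
    have -> : (2 * g)^-1 = g^-1 / 2 :> R by rewrite invfM mulrC.
    have gV0 : 0 < g^-1 :> R by rewrite invr_gt0; lra.
    have : 8 * eta <= g^-1.
      by rewrite -[leRHS]mul1r ler_pdivlMr; [move: small; rewrite mulrAC|lra].
    lra.
  have -> : 3 * n%:R / (2 * g) = 3 * n%:R ^+ 2 * ((n%:R)^-1 * (2 * g)^-1) :> R.
    by field; rewrite !gt_eqF //; lra.
  rewrite -[leLHS]add0r lerD ?mulr_ge0 ?freq_ge0 // ler_wpM2l // mulr_ge0 //.
have diag0 : 0 < gram R q i0 i0.
  by apply: lt_le_trans diag; rewrite divr_gt0 ?mulr_gt0 //; lra.
have prodE : \prod_i gram R q i i = gram R q i0 i0 * \prod_(i | i != i0) gram R q i i.
  by rewrite (bigD1 i0).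
set P' := \prod_(i | i != i0) _ in prodE.
have P'le : P' <= 2 * g / (3 * n%:R) * (expR 2 ^+ #|G| * N * \prod_i p q (q i)).
  have := prod_gram_diag_le R q; rewrite prodE => h.
  have P'0 : 0 <= P' by apply: prodr_ge0 => i _; exact: gram_diag_ge0.
  have -> : P' = 2 * g / (3 * n%:R) * (3 * n%:R / (2 * g) * P').
    by field; rewrite !gt_eqF //; lra.
  rewrite ler_wpM2l ?divr_ge0 ?mulr_ge0 // (le_trans _ h) //.
  exact: ler_wpM2r.
have det_le : moment_term q <= 2 * g * expR 2 ^+ #|G| * (k%:R ^+ 3 / n%:R) * \prod_i p q (q i).
  rewrite /moment_term -/N ler_pdivrMr; last by rewrite mulr_gt0.
  apply: le_trans (det_gram_escape R HZ odd_G iH) _.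
  apply: le_trans (ler_wpM2l _ P'le) _; first by rewrite mulr_ge0 ?exprn_ge0.
  rewrite le_eqVlt; apply/orP; left; apply/eqP; field; exact: lt0r_neq0.
apply: le_trans det_le _.
have A0 : 0 <= g * expR 2 ^+ #|G| * (k%:R ^+ 3 / n%:R) :> R.
  by rewrite !mulr_ge0 ?divr_ge0 ?exprn_ge0.
apply: le_trans (ler_wpM2l _ near_prod_pair) _.
  by rewrite -!(mulrA 2) mulr_ge0.
have -> : 2 * g * expR 2 ^+ #|G| * (k%:R ^+ 3 / n%:R) * (expR (- k%:R / 8) * E * W) =
  2 * (g * expR 2 ^+ #|G| * (k%:R ^+ 3 / n%:R) * (expR (- k%:R / 8) * E * W)) by ring.
have -> : 3 * g * expR 2 ^+ #|G| * E * (k%:R ^+ 3 / n%:R) * expR (- k%:R / 8) * W =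
  3 * (g * expR 2 ^+ #|G| * (k%:R ^+ 3 / n%:R) * (expR (- k%:R / 8) * E * W)) by ring.
by rewrite ler_wpM2r ?mulr_ge0 // ler_nat.
Qed.

End Near.
End MomentTerm.

(** * Evenly spread tuples *)

Lemma prod_lipschitz (R : realFieldType) (I : Type) (r : seq I) (F F' : I -> R) (L delta : R) :
  1 <= L -> 0 <= delta ->
  (forall i, `|F i| <= L) -> (forall i, `|F' i| <= L) ->
  (forall i, `|F i - F' i| <= delta) ->
  `|\prod_(i <- r) F i - \prod_(i <- r) F' i| <= (size r)%:R * L ^+ size r * delta.
Proof.
move=> L1 d0 FL FL' FF'; have L0 : 0 <= L by lra.
elim: r => [|i r IHr]; first by rewrite !big_nil subrr normr0 !mul0r.
rewrite !big_cons /=.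
have -> : F i * \prod_(j <- r) F j - F' i * \prod_(j <- r) F' j =
  F i * (\prod_(j <- r) F j - \prod_(j <- r) F' j) +
  (F i - F' i) * \prod_(j <- r) F' j by ring.
have bnd : `|\prod_(j <- r) F' j| <= L ^+ size r.
  elim: (r) => [|j s IHs]; first by rewrite big_nil normr1.
  by rewrite big_cons normrM exprS ler_pM.
apply: le_trans (ler_normD _ _) _; rewrite !normrM.
apply: (@le_trans _ _ (L * ((size r)%:R * L ^+ size r * delta) + delta * L ^+ size r)).
  by apply: lerD; apply: ler_pM.
rewrite -natr1 exprS.
have : delta * L ^+ size r <= L * (delta * L ^+ size r).
  by rewrite ler_peMl // mulr_ge0 ?exprn_ge0.
move: (L ^+ size r) => z; nra.
Qed.

Lemma det_lipschitz (R : realFieldType) m (A B : 'M[R]_m) (L delta : R) :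
  1 <= L -> 0 <= delta ->
  (forall i j, `|A i j| <= L) -> (forall i j, `|B i j| <= L) ->
  (forall i j, `|A i j - B i j| <= delta) ->
  `|\det A - \det B| <= #|{perm 'I_m}|%:R * (m%:R * L ^+ m) * delta.
Proof.
move=> L1 d0 AL BL AB; rewrite /determinant -sumrB.
apply: le_trans (ler_norm_sum _ _ _) _.
rewrite -mulrA mulr_natl -sumr_const; apply: ler_sum => s _.
rewrite -mulrBr normrM normrX normrN1 expr1n mul1r.
have := @prod_lipschitz R _ (index_enum 'I_m) (fun i => A i (s i)) (fun i => B i (s i))
  L delta L1 d0.
have -> : size (index_enum 'I_m) = m by rewrite -[index_enum _]enumT size_enum_ord.
by apply.
Qed.

Section Bulk.
Variables (R : realType) (G : finZmodType) (n : nat) (q : {ffun 'I_n -> G}) (eta : R).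
Local Notation g := (#|G|%:R).
Local Notation nu := (freq R q).
Local Notation p := (negconv (freq R q)).
Hypotheses (n0 : (0 < n)%N) (near : forall a, `|nu a - g^-1| <= eta)
  (small : 8 * g * eta <= 1).

Let g1 : 1 <= g :> R.
Proof. by rewrite ler1n; apply/card_gt0P; exists 0. Qed.
Let eta0 : 0 <= eta.
Proof. exact: le_trans (normr_ge0 _) (near 0). Qed.

Lemma setT_zmod_closed : zmod_closed [set: G]%SET.
Proof. by split=> [|a b _ _]; rewrite inE. Qed.

Lemma uniform_setT a : uniform R [set: G]%SET a = g^-1.
Proof. by rewrite /uniform inE cardsT mul1r. Qed.

Let d a := nu a - uniform R [set: G]%SET a.
Let x a := g * negconv d a.

Let near_d a : `|d a| <= eta.
Proof. by rewrite /d uniform_setT. Qed.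

(** All cosets of the whole group have the right mass, so the linear term of
    [negconv_near_uniform] vanishes. *)
Lemma bulk_negconv a : g * p a = 1 + g * negconv d a.
Proof.
have gn : g != 0 :> R by rewrite gt_eqF //; have := g1; lra.
rewrite (negconv_near_uniform setT_zmod_closed nu a) uniform_setT -/d.
have -> : coset_mean [set: G]%SET d (- a) = 0.
  rewrite /coset_mean (reindex_inj (addrI a)) /=.
  rewrite (eq_bigl xpredT) => [|b]; last by rewrite !inE.
  under eq_bigr do rewrite addKr.
  by rewrite sumrB sum_freq // sum_uniform ?subrr ?mul0r //; exact: setT_zmod_closed.
by rewrite mulr0 addr0 mulrDr mulfV.
Qed.

Let x_le a : `|x a| <= (g * eta) ^+ 2.
Proof.
rewrite normrM ger0_norm // exprMn expr2 -mulrA ler_wpM2l //.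
exact: negconv_bound.
Qed.

Let y8 : 0 <= g * eta <= 8^-1.
Proof. by rewrite mulr_ge0 //=; have := small; lra. Qed.

Lemma bulk_prod_le : g ^+ n * \prod_i p (q i) <= expR (4 * g ^+ 3 * (n%:R * eta ^+ 3)).
Proof.
have near' a : `|nu a - uniform R [set: G]%SET a| <= eta by rewrite uniform_setT.
have esc : escape [set: G]%SET q = 0%N by apply: eq_card0 => i; rewrite !inE.
have := near_prod setT_zmod_closed n0 near' small ltr01.
have -> : out_mass_supp R [set: G]%SET q = 0.
  by rewrite /out_mass_supp big_pred0 // => a; rewrite inE.
have -> : out_mass R [set: G]%SET q = 0.
  by rewrite /out_mass big_pred0 // => a; rewrite inE.
rewrite esc expr0 !mul1r mul0r subrr add0r.
have -> : \prod_i near_weight R [set: G]%SET q (q i) = (g^-1) ^+ n.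
  rewrite (eq_bigr (fun=> g^-1)) => [|i _]; first by rewrite prodr_const card_ord.
  by rewrite /near_weight inE /escape_rate esc mul0r subr0 mul1r cardsT.
rewrite exprVn => h.
have gn : 0 < g ^+ n :> R by rewrite exprn_gt0 //; have := g1; lra.
by rewrite mulrC -ler_pdivlMr // [4 * _ * _]mulrCA.
Qed.

(** Write [g * p a = 1 + x a], where [x] has order [eta ^ 2] and sum 0. The mean of
    [x] under [freq q] is then its mean under [d], of order [eta ^ 3]. *)
Lemma bulk_prod_ge : expR (- (3 * g ^+ 3 * (n%:R * eta ^+ 3))) <= g ^+ n * \prod_i p (q i).
Proof.
have g1' := g1; have /andP[y0 y1] := y8.
have xb a : - (g * eta) ^+ 2 <= x a <= (g * eta) ^+ 2.
  by have := x_le a; rewrite ler_norml.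
have xs : (g * eta) ^+ 2 <= 64^-1 by nra.
have gp i : 0 < g * p (q i).
  rewrite bulk_negconv; have /andP[] := xb (q i); rewrite /x; lra.
have -> : g ^+ n * \prod_i p (q i) = \prod_i (g * p (q i)).
  by rewrite big_split /= prodr_const card_ord.
apply: le_trans (prod_ge_expR gp); rewrite ler_expR.
rewrite (sum_type q (fun a => 1 - (g * p a)^-1)).
have step a : x a - 2 * ((g * eta) ^+ 2) ^+ 2 <= 1 - (g * p a)^-1.
  have /andP[xa xa'] := xb a; rewrite bulk_negconv -/(x a).
  have x1 : 0 < 1 + x a by lra.
  have -> : 1 - (1 + x a)^-1 = x a / (1 + x a) by field; rewrite gt_eqF.
  rewrite ler_pdivlMr //; move: xa xa' xs; move: (x a) ((g * eta) ^+ 2) => u v; nra.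
have cntE a : (cnt q a)%:R = n%:R * nu a.
  by rewrite /freq mulrC divfK // pnatr_eq0 -lt0n.
have sx : \sum_a x a = 0.
  have : \sum_a g * p a = \sum_a (1 + x a) by apply: eq_bigr => a _; exact: bulk_negconv.
  rewrite -mulr_sumr sum_negconv_freq // mulr1 big_split /= sumr_const.
  by move/eqP; rewrite -subr_eq0 opprD addrA subrr add0r oppr_eq0 => /eqP.
apply: (@le_trans _ _ (n%:R * \sum_a nu a * (x a - 2 * ((g * eta) ^+ 2) ^+ 2))); last first.
  rewrite mulr_sumr; apply: ler_sum => a _; rewrite cntE mulrA ler_wpM2l //.
  by rewrite mulr_ge0 // freq_ge0.
have -> : \sum_a nu a * (x a - 2 * ((g * eta) ^+ 2) ^+ 2) =
   \sum_a d a * x a - 2 * ((g * eta) ^+ 2) ^+ 2.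
  transitivity (\sum_a (d a * x a + g^-1 * x a - nu a * (2 * ((g * eta) ^+ 2) ^+ 2))).
    by apply: eq_bigr => a _; rewrite /d uniform_setT; ring.
  by rewrite sumrB big_split /= -mulr_suml sum_freq // -mulr_sumr sx mulr0 addr0 mul1r.
have dx : - (g * eta * (g * eta) ^+ 2) <= \sum_a d a * x a.
  rewrite lerNl; apply: le_trans (ler_norm _) _; rewrite normrN.
  apply: le_trans (ler_norm_sum _ _ _) _.
  apply: (@le_trans _ _ (\sum_(a : G) eta * (g * eta) ^+ 2)).
    by apply: ler_sum => a _; rewrite normrM ler_pM.
  by rewrite sumr_const -[leLHS]mulr_natl mulrA.
rewrite [3 * _ * _]mulrCA -mulrN ler_wpM2l //.
have -> : 3 * g ^+ 3 * eta ^+ 3 = 3 * (g * eta) ^+ 3 by ring.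
move: dx y0 y1; move: (\sum_a _) (g * eta) => S y dx y0 y1.
have : y ^+ 2 * y ^+ 2 <= y ^+ 3 * 8^-1.
  have -> : y ^+ 2 * y ^+ 2 = y ^+ 3 * y by ring.
  by rewrite ler_wpM2l ?exprn_ge0.
have -> : (y ^+ 2) ^+ 2 = y ^+ 2 * y ^+ 2 by ring.
have : 0 <= y ^+ 3 by exact: exprn_ge0.
move: dx; have -> : y * y ^+ 2 = y ^+ 3 by ring.
lra.
Qed.

Lemma bulk_transition s t : `|transition R q s t - g^-1| <= 4 * eta.
Proof.
have g1' := g1; have /andP[y0 y1] := y8.
rewrite mxE; set a := enum_val t; set b := - _ - _.
have gn : g != 0 :> R by rewrite gt_eqF //; lra.
pose u := g * d a; pose v := g * d b.
have dE c : nu c = g^-1 * (1 + g * d c).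
  by rewrite /d uniform_setT; field.
have pE : p a = g^-1 * (1 + x a) by rewrite -bulk_negconv mulKf.
have ub c : `|g * d c| <= g * eta by rewrite normrM ger0_norm // ler_wpM2l.
have xs : (g * eta) ^+ 2 <= 64^-1 by nra.
have := x_le a; rewrite ler_norml => /andP[xa xa'].
have x1 : 0 < 1 + x a by lra.
have -> : nu a * nu b / p a - g^-1 = g^-1 * (u + v + u * v - x a) / (1 + x a).
  rewrite (dE a) (dE b) pE -/u -/v; field; by rewrite gn gt_eqF.
rewrite normrM normfV [X in _ / X]gtr0_norm // ler_pdivrMr //.
rewrite normrM gtr0_norm ?invr_gt0; last by lra.
rewrite mulrC ler_pdivrMr; last by lra.
have -> : 4 * eta * (1 + x a) * g = 4 * (g * eta) * (1 + x a) by ring.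
have := ub a; have := ub b; rewrite -/u -/v !ler_norml.
move: y0 y1 xa xa' xs; move: (g * eta) (x a) u v => y z u v.
move=> y0 y1 xa xa' xs /andP[? ?] /andP[? ?].
have uv : - (y * 8^-1) <= u * v <= y * 8^-1 by apply/andP; split; nra.
have y2 : y ^+ 2 <= y * 8^-1 by nra.
have yz : - (y * 64^-1) <= y * z by nra.
case/andP: uv => uv uv'; apply/andP; split; nra.
Qed.

(** The comparison matrix, with all entries of [transition] replaced by [g^-1], is
    the identity plus a rank one matrix and has determinant 3. *)
Lemma bulk_det : `|\det (1%:M + 2 *: transition R q) - 3| <=
   8 * (#|{perm 'I_#|G|}|%:R * (g * 4 ^+ #|G|)) * eta.
Proof.
have g1' := g1; have small' := small; have eta0' := eta0.
have gn : g != 0 :> R by rewrite gt_eqF //; lra.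
pose B : 'M[R]_#|G| := 1%:M + 2 *: const_mx g^-1.
have detB : \det B = 3.
  have -> : B = 1%:M + (const_mx 1 : 'cV[R]_#|G|) *m (const_mx (2 / g) : 'rV[R]_#|G|).
    by apply/matrixP => i j; rewrite !mxE big_ord1 !mxE mul1r.
  rewrite det_add1_mulmxC det_mx11 !mxE eqxx mulr1n.
  under eq_bigr do rewrite !mxE mulr1.
  by rewrite sumr_const card_ord -(mulr_natr (2 / _)) divfK //; lra.
have gV : g^-1 <= 1 :> R by rewrite invf_le1 //; lra.
have gV0 : 0 <= g^-1 :> R by rewrite invr_ge0; lra.
have e8 : eta <= 8^-1 by nra.
have diff i j : `|(1%:M + 2 *: transition R q) i j - B i j| <= 8 * eta.
  have := bulk_transition i j; rewrite /B.
  have addE (M : 'M[R]_#|G|) : (1%:M + 2 *: M) i j = 1%:M i j + 2 * M i j.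
    by rewrite [LHS]mxE [X in _ + X]mxE.
  rewrite !addE [const_mx _ i j]mxE.
  set T := transition R q i j; move: (1%:M i j) => z.
  by rewrite !ler_norml => /andP[? ?]; apply/andP; split; lra.
have B4 i j : `|B i j| <= 3.
  rewrite !mxE; case: (i == j); rewrite ?mulr1n ?mulr0n ler_norml; apply/andP; split; lra.
rewrite -detB [8 * _ * eta]mulrAC mulrC.
apply: det_lipschitz => //.
- by lra.
- by lra.
- move=> i j; have := diff i j; have := B4 i j; rewrite !ler_norml.
  by move=> /andP[? ?] /andP[? ?]; apply/andP; split; lra.
- by move=> i j; apply: le_trans (B4 i j) _; lra.
Qed.

End Bulk.

(** * Summation over the tuples close to a subgroup *)

Lemma pow_le_expR (R : realType) N (c : R) : 0 < c ->
  exists2 C : R, 0 <= C & forall x : R, 0 <= x -> x ^+ N <= C * expR (c * x).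
Proof.
move=> c0; case: N => [|N].
  by exists 1 => // x x0; rewrite expr0 mul1r -expR0 ler_expR mulr_ge0 // ltW.
exists (N.+1`!%:R / c ^+ N.+1) => [|x x0]; first by rewrite divr_ge0 // exprn_ge0 // ltW.
have cN : 0 < c ^+ N.+1 by exact: exprn_gt0.
have fN : 0 < N.+1`!%:R :> R by rewrite ltr0n fact_gt0.
rewrite mulrAC ler_pdivlMr // -ler_pdivrMl // mulrC -exprMn [x * c]mulrC.
have := @expR_ge1Dxn R (c * x) N (mulr_ge0 (ltW c0) x0); lra.
Qed.

Section Assembly.
Variables (R : realType) (G : finZmodType).
Local Notation g := (#|G|%:R).

Let g1 : 1 <= g :> R.
Proof. by rewrite ler1n; apply/card_gt0P; exists 0. Qed.

Definition near_uniform n (H : {set G}) (eta : R) (q : {ffun 'I_n -> G}) : bool :=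
  [forall a, `|freq R q a - uniform R H a| <= eta].

(** Both factors of [det_gram_transition], normalized, are close to 1. *)
Lemma bulk_term_bound : exists2 C : R, 0 <= C &
  forall n (q : {ffun 'I_n -> G}) (eta : R), (0 < n)%N ->
    near_uniform [set: G]%SET eta q -> 8 * g * eta <= 1 -> n%:R * eta ^+ 3 <= 1 ->
  `|g ^+ n * moment_term R q - 1| <= C * (eta + n%:R * eta ^+ 3).
Proof.
have g1' := g1.
pose C1 : R := 4 * g ^+ 3 * expR (4 * g ^+ 3).
pose C2 : R := 8 * (#|{perm 'I_#|G|}|%:R * (g * 4 ^+ #|G|)).
have g30 : 0 <= 4 * g ^+ 3 :> R by rewrite mulr_ge0 ?exprn_ge0.
have C10 : 0 <= C1 by rewrite mulr_ge0 ?expR_ge0.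
have C20 : 0 <= C2 by rewrite !mulr_ge0 ?exprn_ge0.
exists (C1 * (1 + C2) + C2) => [|n q eta n0 near small small3].
  by rewrite addr_ge0 // mulr_ge0 // addr_ge0.
have near' a : `|freq R q a - g^-1| <= eta.
  by have /forallP/(_ a) := near; rewrite uniform_setT.
have eta0 : 0 <= eta := le_trans (normr_ge0 _) (near' 0).
have eta1 : eta <= 1 by nra.
set dl := n%:R * eta ^+ 3 in small3 *.
have dl0 : 0 <= dl by rewrite mulr_ge0 ?exprn_ge0.
have le1 := bulk_prod_le n0 near' small.
have ge1 := bulk_prod_ge n0 near' small.
have le2 := bulk_det n0 near' small.
rewrite -/dl in le1 ge1; set X := g ^+ n * _ in le1 ge1.
have p0 i : negconv (freq R q) (q i) != 0.
  apply/eqP => pi0; have := lt_le_trans (expR_gt0 _) ge1.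
  by rewrite /X (bigD1 i) //= pi0 mul0r mulr0 ltxx.
have nn : n%:R != 0 :> R by rewrite pnatr_eq0 -lt0n.
have -> : g ^+ n * moment_term R q = X * (\det (1%:M + 2 *: transition R q) / 3).
  rewrite /moment_term det_gram_transition // /X; field.
  by rewrite expf_neq0 // mulf_neq0 // expf_neq0.
set Y := \det _ in le2 *.
have X1 : `|X - 1| <= C1 * dl.
  have le1' : X <= 1 + C1 * dl.
    apply: le_trans le1 _; set z := 4 * g ^+ 3 * dl.
    have z0 : 0 <= z by rewrite mulr_ge0.
    have ez : expR z * (1 - z) <= 1.
      have := expR_ge1Dx (- z).
      by rewrite expRN -(ler_pM2l (expR_gt0 z)) mulfV ?gt_eqF ?expR_gt0.
    have : z * expR z <= C1 * dl.
      by rewrite /C1 [leRHS]mulrAC -/z ler_wpM2l // ler_expR /z ler_piMr.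
    nra.
  have ge1' : 1 - C1 * dl <= X.
    apply: le_trans ge1; have := expR_ge1Dx (- (3 * g ^+ 3 * dl)).
    have : 3 * g ^+ 3 * dl <= C1 * dl.
      rewrite ler_wpM2r // /C1.
      have : 1 <= expR (4 * g ^+ 3) :> R by rewrite -expR0 ler_expR.
      move: g30; move: (g ^+ 3) (expR _) => u v; nra.
    lra.
  rewrite ler_norml; apply/andP; split; lra.
have Y1 : `|Y / 3 - 1| <= C2 * eta.
  have C2e : 0 <= C2 * eta by rewrite mulr_ge0.
  move: le2; rewrite -/C2 !ler_norml => /andP[? ?]; apply/andP; split; lra.
have -> : X * (Y / 3) - 1 = (X - 1) * (1 + (Y / 3 - 1)) + (Y / 3 - 1) by ring.
apply: le_trans (ler_normD _ _) _; rewrite normrM.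
have Y2 : `|1 + (Y / 3 - 1)| <= 1 + C2.
  apply: le_trans (ler_normD _ _) _; rewrite normr1 lerD2l.
  by apply: le_trans Y1 _; rewrite ler_piMr.
have : `|X - 1| * `|1 + (Y / 3 - 1)| <= C1 * dl * (1 + C2) by apply: ler_pM.
have : 0 <= C1 * (1 + C2) * eta by rewrite !mulr_ge0 // addr_ge0.
have : 0 <= C2 * dl by rewrite mulr_ge0.
nra.
Qed.

Lemma geometric_le (r : R) N : 0 <= r < 1 -> \sum_(j < N) r ^+ j <= (1 - r)^-1.
Proof.
move=> /andP[r0 r1]; have r1' : 0 < 1 - r by lra.
rewrite -[leRHS]mul1r ler_pdivlMr // mulrC.
have -> : (1 - r) * \sum_(j < N) r ^+ j = 1 - r ^+ N.
  by rewrite -[RHS]opprB subrX1 -mulNr opprB.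
have := exprn_ge0 N r0; lra.
Qed.

(** The comparison weight depends on [q] only through the numbers [f a] of values
    [a] outside [H], so [sum_class_le] reduces the sum to
    [\sum_f k^3 exp (- k / 8)] with [k = \sum_a f a], which a product of geometric
    series dominates. *)
Lemma near_sum_bound : coprime #|G| 2 -> exists2 C : R, 0 <= C &
  forall (H : {set G}) n (eta : R), zmod_closed H -> H != [set: G]%SET ->
    (0 < n)%N -> 8 * g * eta <= 1 -> n%:R * eta ^+ 3 <= 1 ->
  \sum_(q : {ffun 'I_n -> G} | near_uniform H eta q && generates q) moment_term R q
    <= C / n%:R.
Proof.
move=> odd_G; have g1' := g1.
(* Half of the rate [1 / 8] absorbs the factor [k ^ 3]. *)
have c16 : 0 < 16^-1 :> R by lra.
have [K K0 cube] := pow_le_expR 3 c16.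
pose r : R := expR (- 16^-1).
have r01 : 0 <= r < 1 by rewrite expR_ge0 /= -expR0 ltr_expR; lra.
pose C1 : R := 3 * g * expR 2 ^+ #|G| * expR (4 * g ^+ 3).
have C10 : 0 <= C1 by rewrite !mulr_ge0 ?exprn_ge0 ?expR_ge0.
have rV : 0 <= (1 - r)^-1 by rewrite invr_ge0; case/andP: r01 => *; lra.
exists (C1 * K * (1 - r)^-1 ^+ #|G|) => [|H n eta HZ HT n0 small small3].
  by rewrite !mulr_ge0 ?exprn_ge0.
pose T := {ffun G -> 'I_n.+1}.
pose tot (f : T) : nat := (\sum_a f a)%N.
pose cl (q : {ffun 'I_n -> G}) : T := [ffun a => if a \in H then ord0 else inord (cnt q a)].
(* The absolute value only makes [w] nonnegative at the [f] outside the range of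
   [cl]; on that range it acts on a nonnegative number. *)
pose w (f : T) a : R :=
  if a \in H then `|1 - (tot f)%:R / n%:R| / #|H|%:R else (f a)%:R / n%:R.
pose c (f : T) : R := C1 * ((tot f)%:R ^+ 3 / n%:R) * expR (- (tot f)%:R / 8).
have nn : n%:R != 0 :> R by rewrite pnatr_eq0 -lt0n.
have clE q a : (cl q a)%:R = if a \in H then 0 else (cnt q a)%:R :> R.
  rewrite ffunE; case: ifP => // _; rewrite inordK // ltnS.
  by rewrite -[n in (_ <= n)%N]card_ord max_card.
have totE q : tot (cl q) = escape H q.
  apply/eqP; rewrite -(eqr_nat R) natr_sum /=.
  have := escape_rateE R H q; rewrite -mulr_suml => /(mulIf (invr_neq0 nn)) ->.
  rewrite [eqbRHS]big_mkcond /=; apply/eqP; apply: eq_bigr => a _.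
  by rewrite clE; case: (a \in H).
have wE q a : w (cl q) a = near_weight R H q a.
  rewrite /w /near_weight totE clE; case: (a \in H) => //; rewrite ger0_norm //.
  rewrite -/(escape_rate R H q) -sum_freq_in //.
  by apply: sumr_ge0 => b _; exact: freq_ge0.
have cE q : near_uniform H eta q && generates q ->
    moment_term R q <= c (cl q) * \prod_i w (cl q) (q i).
  move=> /andP[/forallP near gen]; rewrite /c totE.
  under eq_bigr do rewrite wE.
  apply: near_term_le => //.
  rewrite lt0n; apply: contra HT => /eqP e0; apply/eqP.
  apply: generates_sub gen _ => // i; apply/negPn/negP => iH.
  have : i \in [pred i | q i \notin H] by rewrite inE.
  by rewrite (card0_eq e0).
have c0 f : 0 <= c f by rewrite !mulr_ge0 ?exprn_ge0 ?expR_ge0 ?invr_ge0.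
have w0 f a : 0 <= w f a by rewrite /w; case: ifP => _; rewrite divr_ge0.
apply: (@le_trans _ _ (\sum_q c (cl q) * \prod_i w (cl q) (q i))).
  rewrite big_mkcond; apply: ler_sum => q _; case: ifP => [/cE//|_].
  by rewrite mulr_ge0 // prodr_ge0.
apply: (@le_trans _ _ (\sum_f c f)).
  apply: sum_class_le => // q; under eq_bigr do rewrite wE.
  by rewrite sum_near_weight.
have cf f : c f <= C1 * K / n%:R * \prod_a r ^+ f a.
  have -> : \prod_a r ^+ f a = expR (- (tot f)%:R / 16).
    under eq_bigr do rewrite -expRM_natl.
    by rewrite -expR_sum -mulr_suml -natr_sum mulrN mulNr.
  rewrite /c; have -> : - (tot f)%:R / 8 = - (tot f)%:R / 16 - 16^-1 * (tot f)%:R :> R by lra.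
  rewrite expRD expRN.
  set k := (tot f)%:R; set e := expR (_ / _); set e' := expR _.
  have k3 : k ^+ 3 * e'^-1 <= K by rewrite ler_pdivrMr ?expR_gt0 // cube.
  have -> : C1 * (k ^+ 3 / n%:R) * (e / e') = C1 / n%:R * e * (k ^+ 3 / e') by ring.
  have -> : C1 * K / n%:R * e = C1 / n%:R * e * K by ring.
  by rewrite ler_wpM2l // !mulr_ge0 ?invr_ge0 ?expR_ge0.
apply: le_trans (ler_sum _ (fun f _ => cf f)) _.
rewrite -mulr_sumr [leRHS]mulrAC ler_wpM2l //.
  by rewrite !mulr_ge0 ?invr_ge0.
rewrite -(bigA_distr_bigA (fun (a : G) (j : 'I_n.+1) => r ^+ j)) /= -prodr_const.
apply: ler_prod => a _; rewrite geometric_le // sumr_ge0 // => j _.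
by rewrite exprn_ge0 // expR_ge0.
Qed.

End Assembly.

(** * The limit *)

Section Final.
Variables (R : realType) (G : finZmodType).
Local Notation g := (#|G|%:R).

Let g1 : 1 <= g :> R.
Proof. by rewrite ler1n; apply/card_gt0P; exists 0. Qed.

Definition far_from_fixed n (t : R) (q : {ffun 'I_n -> G}) : bool :=
  [exists a, t < `|freq R q a - negconv (freq R q) a|].

Lemma far_sum_le n (t : R) : (0 < n)%N -> 0 <= t ->
  \sum_(q : {ffun 'I_n -> G} | far_from_fixed t q) moment_term R q <=
  expR 2 ^+ #|G| / 3 * (expR (- n%:R * t ^+ 2 / 4) * n.+1%:R ^+ #|G|).
Proof.
move=> n0 t0.
have C0 : 0 <= expR 2 ^+ #|G| / 3 :> R by rewrite divr_ge0 ?exprn_ge0 ?expR_ge0.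
have typeP := sum_prod_freq_le R (far_from_fixed t) n0.
apply: le_trans (ler_wpM2l C0 (ler_wpM2l (expR_ge0 _) typeP)).
rewrite !mulr_sumr; apply: ler_sum => q /existsP[a /ltW ta].
apply: le_trans (moment_term_le R n0 q) _; rewrite ler_wpM2l //.
apply: prod_le_far ta => //; last exact: sum_negconv_freq.
by move=> b; exact: negconv_ge0.
Qed.

Lemma not_bulk_sum_le n (eta : R) : (0 < n)%N -> 0 <= eta ->
  \sum_(q : {ffun 'I_n -> G} | ~~ near_uniform [set: G]%SET eta q) (g^-1) ^+ n <=
  expR (- n%:R * eta ^+ 2 / 4) * n.+1%:R ^+ #|G|.
Proof.
move=> n0 e0; have g1' := g1.
apply: le_trans (ler_wpM2l (expR_ge0 _) (sum_prod_freq_le R _ n0)).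
rewrite mulr_sumr; apply: ler_sum => q; rewrite negb_forall => /existsP[a].
rewrite -ltNge uniform_setT => /ltW ea.
have := @prod_le_far R G n q (fun=> g^-1) a eta n0 _ _ e0 ea.
rewrite prodr_const card_ord sumr_const -[g^-1 *+ _]mulr_natl mulfV; last first.
  by rewrite gt_eqF //; lra.
by apply => // _; rewrite invr_ge0; lra.
Qed.

Lemma near_full_generates n (eta : R) (q : {ffun 'I_n -> G}) :
  g * eta < 1 -> near_uniform [set: G]%SET eta q -> generates q.
Proof.
move=> ge /forallP near; apply: generates_onto => a; have g1' := g1.
have := near a; rewrite uniform_setT ler_norml => /andP[lo _].
have gV : eta < g^-1 by rewrite -[ltRHS]mul1r ltr_pdivlMr; lra.
have : 0 < freq R q a by lra.
rewrite /freq; case: (posnP (cnt q a)) => [->|/card_gt0P[i]]; first by rewrite mul0r ltxx.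
by rewrite inE => /eqP; exists i.
Qed.

(** The distribution of [q] either fails [nu = negconv nu] by more than [s ^ 2], or
    is close to a uniform measure by [stability]; the full group is singled out
    because it alone contributes to the limit. *)
Lemma trichotomy n (s : R) (q : {ffun 'I_n -> G}) : coprime #|G| 6 -> (0 < n)%N ->
  0 < s -> 12 * g ^+ 2 * s <= 1 ->
  [|| near_uniform [set: G]%SET (6 * s ^+ 2) q, far_from_fixed (s ^+ 2) q |
   [exists H : {set G}, [&& `[< zmod_closed H >], H != [set: G]%SET &
      near_uniform H (6 * s ^+ 2) q]]].
Proof.
move=> cop n0 s0 sG; case: (boolP (far_from_fixed _ q)) => [|near]; first by rewrite orbT.
rewrite negb_exists in near; move/forallP: near => near.
have [|H HZ nearH] := stability cop (freq_ge0 R q) (sum_freq R q n0) s0 sG.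
  by move=> a; have := near a; rewrite -leNgt.
have nH : near_uniform H (6 * s ^+ 2) q by apply/forallP.
have [HT|HT] := eqVneq H [set: G]%SET; first by rewrite -HT nH.
apply/orP; right; apply/existsP; exists H; rewrite HT nH.
by apply/and3P; split=> //; apply/asboolP.
Qed.

(** Here [x = n^(1/5)] and the precision in [trichotomy] is [s = 1 / x], so that
    [n eta^2 = 36 x] and [n eta^3 = 216 / x] with [eta = 6 s^2]. *)
Theorem moment_sum_bound : coprime #|G| 6 -> exists2 C : R, 0 <= C &
  forall n (x : R), (0 < n)%N -> x ^+ 5 = n%:R -> 216 * g ^+ 2 <= x ->
  `|\sum_(q : {ffun 'I_n -> G} | generates q) moment_term R q - 1| <= C / x.
Proof.
move=> cop; have g1' := g1.
have odd_G : coprime #|G| 2 by move: cop; rewrite -[6%N]/(2 * 3)%N coprimeMr => /andP[].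
have [Cb Cb0 bulkP] := bulk_term_bound R G.
have [Cn Cn0 nearP] := near_sum_bound R odd_G.
have c4 : 0 < 4^-1 :> R by lra.
have [K K0 powP] := pow_le_expR (5 * #|G|).+1 c4.
pose C3 : R := 2 ^+ #|G| * K.
have C30 : 0 <= C3 by rewrite mulr_ge0 ?exprn_ge0.
pose Ce : R := expR 2 ^+ #|G| / 3.
have Ce0 : 0 <= Ce by rewrite divr_ge0 ?exprn_ge0 ?expR_ge0.
exists (222 * Cb + C3 + Ce * C3 + #|{set G}|%:R * Cn) => [|n x n0 xn xg].
  by rewrite !addr_ge0 // !mulr_ge0.
have g2 : 1 <= g ^+ 2 :> R by rewrite exprn_ege1.
have x216 : 216 <= x by lra.
have x0 : 0 < x by lra.
have x0' : 0 <= x by exact: ltW.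
have xn0 : x != 0 by rewrite gt_eqF.
pose s := x^-1; pose eta := 6 * s ^+ 2.
have s0 : 0 < s by rewrite invr_gt0.
have sG : 12 * g ^+ 2 * s <= 1 by rewrite ler_pdivrMr //; lra.
have e3 : n%:R * eta ^+ 3 = 216 / x.
  by rewrite -xn /eta /s; field.
have small3 : n%:R * eta ^+ 3 <= 1 by rewrite e3 ler_pdivrMr //; lra.
have s1 : s <= 216^-1 by rewrite lef_pV2 ?posrE.
have small : 8 * g * eta <= 1.
  have gg : g <= g ^+ 2 :> R by rewrite expr2 ler_peMl //; lra.
  have : 12 * g * s <= 1 by nra.
  rewrite /eta; nra.
have eta0 : 0 <= eta by rewrite mulr_ge0 ?exprn_ge0 // ltW.
have ge1 : g * eta < 1.
  by have : 0 <= g * eta by [rewrite mulr_ge0]; lra.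
have nx : x <= n%:R by rewrite -xn ler_eXnr //; lra.
have nn : 0 < n%:R :> R by rewrite ltr0n.
(* Exponential decay in [x = n^(1/5)] beats the number of types. *)
have decay (y : R) : x / 4 <= y -> expR (- y) * n.+1%:R ^+ #|G| <= C3 / x.
  move=> xy; rewrite ler_pdivlMr //.
  have n2 : n.+1%:R <= 2 * x ^+ 5.
    by rewrite xn -natr1; have : 1 <= n%:R :> R by [rewrite ler1n]; lra.
  apply: (@le_trans _ _ (expR (- (4^-1 * x)) * (2 * x ^+ 5) ^+ #|G| * x)).
    rewrite ler_wpM2r //; apply: ler_pM; rewrite ?expR_ge0 ?exprn_ge0 //.
      by rewrite ler_expR; lra.
    by rewrite lerXn2r ?nnegrE ?mulr_ge0 ?exprn_ge0.
  rewrite exprMn -exprM expRN.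
  have -> : (expR (4^-1 * x))^-1 * (2 ^+ #|G| * x ^+ (5 * #|G|)) * x =
     2 ^+ #|G| * (x ^+ (5 * #|G|).+1 / expR (4^-1 * x)).
    by rewrite exprS; field; rewrite gt_eqF ?expR_gt0.
  rewrite ler_wpM2l ?exprn_ge0 // ler_pdivrMr ?expR_gt0 //.
  by apply: powP; exact: ltW.
rewrite (bigID (near_uniform [set: G]%SET eta)) /= addrAC.
apply: le_trans (ler_normD _ _) _.
have -> : (222 * Cb + C3 + Ce * C3 + #|{set G}|%:R * Cn) / x =
   (222 * Cb / x + C3 / x) + (Ce * (C3 / x) + #|{set G}|%:R * (Cn / x)) by field.
apply: lerD.
  rewrite (eq_bigl (near_uniform [set: G]%SET eta)) => [|q]; last first.
    by rewrite andbC; apply/andb_idr; exact: near_full_generates.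
  have gn : g ^+ n != 0 :> R by rewrite expf_neq0 // gt_eqF //; lra.
  have one : 1 = \sum_(q : {ffun 'I_n -> G}) (g^-1) ^+ n :> R.
    rewrite sumr_const card_ffun card_ord -[_ *+ _]mulr_natl natrX -exprMn mulfV ?expr1n //.
    by rewrite gt_eqF //; lra.
  rewrite [X in _ - X]one [X in _ - X](bigID (near_uniform [set: G]%SET eta)) /= opprD addrA.
  apply: le_trans (ler_normB _ _) _; apply: lerD.
    rewrite -sumrB; apply: le_trans (ler_norm_sum _ _ _) _.
    apply: (@le_trans _ _ (\sum_(q : {ffun 'I_n -> G}) (g^-1) ^+ n * (222 * Cb / x))).
      rewrite [leLHS]big_mkcond; apply: ler_sum => q _; case: ifP => [near|_]; last first.
        by rewrite !mulr_ge0 ?exprn_ge0 ?invr_ge0.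
      have -> : moment_term R q - g^-1 ^+ n = g^-1 ^+ n * (g ^+ n * moment_term R q - 1).
        by rewrite exprVn; field.
      rewrite normrM ger0_norm ?exprn_ge0 ?invr_ge0 // ler_wpM2l ?exprn_ge0 ?invr_ge0 //.
      apply: le_trans (bulkP n q eta n0 near small small3) _.
      have -> : 222 * Cb / x = Cb * (222 * s) by rewrite /s; ring.
      by rewrite e3 ler_wpM2l // -/s /eta; nra.
    by rewrite -mulr_suml -one mul1r.
  rewrite ger0_norm; last by apply: sumr_ge0 => q _; rewrite exprn_ge0 ?invr_ge0.
  apply: le_trans (not_bulk_sum_le n0 eta0) _; rewrite !mulNr; apply: decay.
  have -> : n%:R * eta ^+ 2 = 36 * x by rewrite -xn /eta /s; field.
  lra.
rewrite ger0_norm; last by apply: sumr_ge0 => q _; exact: moment_term_ge0.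
pose bad (H : {set G}) := `[< zmod_closed H >] && (H != [set: G]%SET).
apply: (@le_trans _ _ (
   \sum_(q : {ffun 'I_n -> G} | far_from_fixed (s ^+ 2) q) moment_term R q +
   \sum_(H : {set G} | bad H)
      \sum_(q : {ffun 'I_n -> G} | near_uniform H eta q && generates q) moment_term R q)).
  rewrite (exchange_big_dep xpredT) //= big_mkcond [X in _ <= X + _]big_mkcond.
  rewrite -big_split /=.
  apply: ler_sum => q _; have mt0 := moment_term_ge0 R q.
  have sum0 (P : pred {set G}) : 0 <= \sum_(H : {set G} | P H) moment_term R q.
    exact: sumr_ge0.
  case: ifP => [/andP[gen notbulk]|_]; last by rewrite addr_ge0 //; case: ifP.
  have /or3P[bulk|far|/existsP[H /and3P[HZ HT nearH]]] := trichotomy q cop n0 s0 sG.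
  - by rewrite bulk in notbulk.
  - by rewrite far lerDl.
  rewrite [X in _ <= _ + X](bigD1 H) /=; last by rewrite /bad HZ HT nearH gen.
  by rewrite addrCA lerDl addr_ge0 //; case: ifP.
apply: lerD.
  apply: le_trans (far_sum_le n0 _) _; first by rewrite exprn_ge0 // ltW.
  rewrite ler_wpM2l // !mulNr; apply: decay.
  have -> : n%:R * (s ^+ 2) ^+ 2 = x by rewrite -xn /s; field.
  exact: lexx.
apply: (@le_trans _ _ (\sum_(H : {set G}) Cn / x)); last by rewrite sumr_const mulr_natl.
rewrite big_mkcond; apply: ler_sum => H _.
case: ifP => [/andP[/asboolP HZ HT]|_]; last by rewrite divr_ge0.
apply: le_trans (nearP H n eta HZ HT n0 small small3) _.
by rewrite ler_wpM2l // lef_pV2 ?posrE.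
Qed.

End Final.

Local Open Scope classical_set_scope.

Theorem theorem2 (R : realType) (G : finZmodType) (hG : coprime #|G| 6) :
  expect (R := R) (fun K : nsubset n => (nb_Sur (cok (Bsub K)) G)%:R : R)
    @[n --> \oo] --> (1 : R).
Proof.
have [C C0 bnd] := moment_sum_bound R hG.
apply/cvgrPdist_le => /= e e0.
set X := Num.max (216 * #|G|%:R ^+ 2) (C / e) : R.
have X0 : 0 <= X by rewrite le_max mulr_ge0 ?exprn_ge0.
near=> n.
have n0 : (0 < n)%N by near: n; exists 1%N.
have nX : X ^+ 5 <= n%:R by near: n; exact: nbhs_infty_ger.
pose x : R := n%:R `^ 5^-1.
have xn : x ^+ 5 = n%:R.
  by rewrite -powR_mulrn ?powR_ge0 // -powRrM mulVf // powRr1.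
have Xx : X <= x.
  by rewrite -(@ler_pXn2r _ 5) ?nnegrE ?powR_ge0 // xn.
have x0 : 0 < x by rewrite powR_gt0 // ltr0n.
rewrite distrC expect_nb_Sur.
under eq_bigr do rewrite det_gram0 //.
apply: le_trans (bnd n x n0 xn _) _; first by apply: le_trans Xx; rewrite le_max lexx.
rewrite ler_pdivrMr // mulrC -ler_pdivrMr //; apply: le_trans Xx.
by rewrite le_max lexx orbT.
Unshelve. all: by end_near.
Qed.
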